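(* Let $d\ge3$ and let $a\in L_1(\mathbb R^d)$ have compact support. Suppose the Toeplitz operator $T_a$ on $\mathcal H$ defined by the sesquilinear form $F_a(u,v)=\int_{\mathbb R^d}a(x)u(x)\overline{v(x)}\,dx$ has finite rank. Then $a=0$ almost everywhere in $\mathbb R^d$.
   Context: Let $\mathbb S=S^{d-1}$ with surface measure $dS$, $c_d=\sqrt{\pi}/(2\pi)^{d/2}$, $(I\varphi)(x)=c_d\int_{\mathbb S}\varphi(\xi)e^{ix\cdot\xi}dS(\xi)$ for $\varphi\in L_2(\mathbb S)$. The Herglotz space $\mathcal H=\{I\varphi:\varphi\in L_2(\mathbb S)\}$ is a Hilbert space with inner product $\langle I\varphi,I\psi\rangle=\int_{\mathbb S}\varphi\bar\psi\,dS$. For a bounded sesquilinear form $F$ on $\mathcal H$ the Toeplitz operator $T_F$ is the bounded operator with $\langle T_Fu,v\rangle=F(u,v)$ (equivalently $(T_Fu)(x)=F(u,k_x)$, $k_x$ the reproducing kernel of $\mathcal H$); $T_a=T_{F_a}$. For compactly supported $a\in L_1$ the form $F_a$ is bounded on $\mathcal H$. *)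

(* Defs.v *)
From HB Require Import structures.
From mathcomp Require Import all_boot all_order all_algebra.
From mathcomp Require Import all_classical all_reals all_analysis.
From mathcomp Require Import complex.
Set Implicit Arguments. Unset Strict Implicit. Unset Printing Implicit Defensive.
Import Order.TTheory GRing.Theory Num.Theory.
Import numFieldNormedType.Exports.
Local Open Scope classical_set_scope.
Local Open Scope ring_scope.
Local Open Scope complex_scope.

Record mspace (R : realType) := MSpace {
  ms_disp : measure_display;
  ms_type : measurableType ms_disp;
  ms_meas : {measure set ms_type -> \bar R} }.

(* R^n realised as the iterated product ((unit * R) * R) * ... * R with the
   iterated product of one-dimensional Lebesgue measures, i.e. the Lebesgue
   measure on the product sigma-algebra (= Borel sigma-algebra) of R^n. *)
Fixpoint Rn_space (R : realType) (n : nat) : mspace R :=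
  match n with
  | 0 => @MSpace R _ unit (@dirac _ unit tt R)
  | n'.+1 => @MSpace R _ _
       ((ms_meas (Rn_space R n') \x (@lebesgue_measure R))%E)
  end.

Definition Rd (R : realType) (n : nat) := ms_type (Rn_space R n).
Definition leb (R : realType) (n : nat) : {measure set Rd R n -> \bar R} :=
  ms_meas (Rn_space R n).

Section Euclid.
Variable R : realType.

Fixpoint dotR (n : nat) : Rd R n -> Rd R n -> R :=
  match n return Rd R n -> Rd R n -> R with
  | 0 => fun _ _ => 0
  | n'.+1 => fun (x y : (Rd R n' * R)%type) => @dotR n' x.1 y.1 + x.2 * y.2
  end.

Fixpoint scaleRd (n : nat) (t : R) : Rd R n -> Rd R n :=
  match n return Rd R n -> Rd R n with
  | 0 => fun x => x
  | n'.+1 => fun (x : (Rd R n' * R)%type) => ((@scaleRd n' t x.1, t * x.2) : (Rd R n' * R)%type)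
  end.

Definition eucl_norm (n : nat) (x : Rd R n) : R := Num.sqrt (dotR x x).

Definition sphere (n : nat) : set (Rd R n) := [set x | dotR x x = 1].

Definition normalize (n : nat) (x : Rd R n) : Rd R n :=
  scaleRd (eucl_norm x)^-1 x.

End Euclid.

Section Complex.
Variable R : realType.
Local Notation C := (R[i]).

Definition cabs (z : C) : R := Num.sqrt (complex.Re z ^+ 2 + complex.Im z ^+ 2).
Definition cexpi (t : R) : C := Complex (cos t) (sin t).

Definition Cint d (T : measurableType d) (mu : {measure set T -> \bar R})
    (D : set T) (f : T -> C) : C :=
  Complex (Rintegral mu D (fun x => complex.Re (f x)))
          (Rintegral mu D (fun x => complex.Im (f x))).

Definition Cmeasurable d (T : measurableType d) (D : set T) (f : T -> C) :=
  measurable_fun D (fun x => complex.Re (f x)) /\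
  measurable_fun D (fun x => complex.Im (f x)).

(* Integral over the unit sphere S^{n-1} with respect to surface measure dS,
   via the cone formula  int_S g dS = n * int_{0 < |x| <= 1} g(x/|x|) dx,
   i.e. S(A) = n * Lebesgue measure of the cone {t xi : xi in A, 0 < t <= 1}. *)
Definition punctured_ball (n : nat) : set (Rd R n) :=
  [set x | 0 < dotR x x <= 1].

Definition Sint (n : nat) (g : Rd R n -> C) : C :=
  (n%:R)%:C * Cint (leb R n) (@punctured_ball n) (fun x => g (normalize x)).

(* phi in L_2(S^{n-1}) (phi is given on R^n, only its values on the sphere
   matter) *)
Definition L2S (n : nat) (phi : Rd R n -> C) : Prop :=
  Cmeasurable (@sphere R n) phi /\
  (\int[leb R n]_(x in @punctured_ball n) ((cabs (phi (normalize x))) ^+ 2)%:E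
     < +oo)%E.

Definition c_const (n : nat) : R := Num.sqrt pi / (2 * pi) `^ (n%:R / 2).

Definition herglotz (n : nat) (phi : Rd R n -> C) : Rd R n -> C :=
  fun x => (c_const n)%:C * Sint (fun xi => phi xi * cexpi (dotR x xi)).

(* inner product of H:  <I phi, I psi> = int_S phi conj(psi) dS *)
Definition H_inner (n : nat) (phi psi : Rd R n -> C) : C :=
  Sint (fun xi => phi xi * conjc (psi xi)).

Definition Fa (n : nat) (a u v : Rd R n -> C) : C :=
  Cint (leb R n) setT (fun x => a x * u x * conjc (v x)).

Definition L1 (n : nat) (a : Rd R n -> C) : Prop :=
  Cmeasurable setT a /\
  (\int[leb R n]_x (cabs (a x))%:E < +oo)%E.

Definition compact_support (n : nat) (a : Rd R n -> C) : Prop :=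
  exists r : R, {ae leb R n, forall x, r < dotR x x -> a x = 0}.

(* The Toeplitz operator T_a (<T_a u, v> = F_a(u,v) for u, v in H) has finite
   rank: its range is contained in the span of finitely many elements
   I psi_1, ..., I psi_k of H. Since every element of H is of the form I phi,
   and T_a u = sum_j c_j I psi_j iff for all v = I psi in H,
   F_a(u, v) = <sum_j c_j I psi_j, I psi> = sum_j c_j int_S psi_j conj(psi) dS. *)
Definition toeplitz_finite_rank (n : nat) (a : Rd R n -> C) : Prop :=
  exists (k : nat) (psi : 'I_k -> Rd R n -> C),
    (forall j, L2S (psi j)) /\
    forall phi, L2S phi ->
      exists c : 'I_k -> C,
        forall psi', L2S psi' ->
          Fa a (herglotz phi) (herglotz psi') =
          \sum_(j < k) c j * H_inner (psi j) psi'.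

End Complex.

(* Main.v *)
(* Write A(t) for the Fourier transform of a at t. Indicators of shrinking
   spherical caps, suitably normalised, turn Herglotz functions into plane waves
   e^{i x.xi}, so a finite rank < N gives det [A(xi_i - eta_j)]_{i,j<N} = 0 for
   all points xi_i, eta_j of the real unit sphere.

   Take unit vectors n_i and vectors t_i = t' + u_i with t_i of equal length < 2
   and orthogonal to n_i, where u_i, n_i lie in a common plane orthogonal to t',
   and a unit vector e orthogonal to t' and to that plane (here d >= 3 is used).
   The points c n_i + w e + t_i/2 and c n_j + w e - t_j/2 lie on the sphere when
   c^2 + w^2 = 1 - |t_i|^2/4, and their differences
   c (n_i - n_j) + (t_i + t_j)/2 do not involve w. Since a has compact support,
   the determinant is an entire function of c; it vanishes for small real c,
   hence for all real c. As c -> oo the off-diagonal entries tend to 0 by the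
   Riemann-Lebesgue lemma, while the diagonal ones are A(t_i), so the product of
   the A(t_i) is 0. Letting the distinct t_i tend to a common t gives A(t) = 0
   on an open set; by analyticity A = 0, and a = 0 almost everywhere. *)
Require Import Defs.
From HB Require Import structures.
From mathcomp Require Import all_boot all_order all_algebra.
From mathcomp Require Import all_classical all_reals all_analysis.
From mathcomp Require Import measurable_realfun.
From mathcomp Require Import complex.
From mathcomp Require Import ring lra.
Import Order.TTheory GRing.Theory Num.Theory.
Import numFieldNormedType.Exports.
Local Open Scope classical_set_scope.
Local Open Scope ring_scope.

(** * Entire functions with explicit Taylor bounds *)

(** Differences of two points of the sphere have length at most 2, so no choice of points makes the
    off-diagonal entries small. Only the continuation in [c] leaves this ball, and the extra
    direction [e] is what turns [c] into a free parameter. All continuation happens along real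
    lines: in [c], and at the end along a line through a fixed base point. A one-variable identity
    theorem therefore suffices, and complex values are handled as pairs of cosine and sine
    integrals. The notion of entire function below is tailored to this. Its remainder bound has one
    constant [C] for all real [c], so the case [N = 0] bounds [f] on the whole line: these are
    functions of exponential type bounded on the reals. Such bounds are inherited from the cosine by
    integration over a compact set, and they survive sums and products, hence determinants. The
    Riemann-Lebesgue lemma is proved along integer multiples of a vector whose last coordinate is
    nonzero, and the vectors n_i are placed so that their differences have this property. *)

Definition taylor_entire {R : realType} (f : R -> R) : Prop :=
  exists (s : nat -> R) (C B : R),
    [/\ 0 <= C, 0 <= B,
        forall n, `|s n| <= C * (B ^+ n / n`!%:R) &
        forall N c,
          `|f c - \sum_(n < N) s n * c ^+ n| <= C * ((B * `|c|) ^+ N / N`!%:R)].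

Section TaylorEntire.
Context {R : realType}.
Implicit Types f g : R -> R.

Lemma fact_gt0R n : 0 < n`!%:R :> R.
Proof. by rewrite ltr0n fact_gt0. Qed.

(** This is the binomial theorem divided by [N!]. It says that the majorants [B^n/n!] and [B'^n/n!]
    convolve to [(B + B')^n/n!], which makes [taylor_entire] stable under products. *)
Lemma binomial_fact (x y : R) N :
  \sum_(i < N.+1) (x ^+ i / i`!%:R) * (y ^+ (N - i) / (N - i)`!%:R)
  = (x + y) ^+ N / N`!%:R.
Proof.
rewrite addrC exprDn mulr_suml; apply: eq_bigr => i _.
have iN : (i <= N)%N by rewrite -ltnS.
have := bin_fact iN; move=> /(congr1 (fun k => k%:R : R)); rewrite !natrM => E.
rewrite -E -mulr_natr.
have f1 := lt0r_neq0 (fact_gt0R i); have f2 := lt0r_neq0 (fact_gt0R (N - i)).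
have f3 : 'C(N, i)%:R != 0 :> R by rewrite pnatr_eq0 -lt0n bin_gt0.
by field; rewrite f1 f2 f3.
Qed.

Lemma triangular_sum (a b : nat -> R) N :
  \sum_(n < N) \sum_(i < n.+1) a i * b (n - i)%N
  = \sum_(i < N) a i * \sum_(j < N - i) b j.
Proof.
elim: N => [|N IH]; first by rewrite !big_ord0.
rewrite big_ord_recr/= IH [RHS]big_ord_recr/= [X in _ + X]big_ord_recr/= addrA.
rewrite -big_split/= subnn subSnn big_ord1; congr (_ + _).
by apply: eq_bigr => i _; rewrite subSn ?(ltnW (ltn_ord i))// big_ord_recr/= mulrDr.
Qed.

Lemma taylor_entireM f g :
  taylor_entire f -> taylor_entire g -> taylor_entire (fun c => f c * g c).
Proof.
move=> [s [C [B [C0 B0 sB fB]]]] [t [C' [B' [C'0 B'0 tB gB]]]].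
exists (fun n => \sum_(i < n.+1) s i * t (n - i)%N), (C * C'), (B + B').
split; [exact: mulr_ge0 | exact: addr_ge0 | move=> n | move=> N c].
  apply: (le_trans (ler_norm_sum _ _ _)).
  rewrite -binomial_fact mulr_sumr; apply: ler_sum => i _.
  rewrite normrM mulrACA; apply: ler_pM => //.
have gC : `|g c| <= C' by have := gB 0 c; rewrite big_ord0 subr0 expr0 fact0 divr1 mulr1.
have -> : \sum_(n < N) (\sum_(i < n.+1) s i * t (n - i)%N) * c ^+ n
   = \sum_(i < N) s i * c ^+ i * \sum_(j < N - i) t j * c ^+ j.
  rewrite -(triangular_sum (fun i => s i * c ^+ i) (fun i => t i * c ^+ i)).
  apply: eq_bigr => n _; rewrite mulr_suml; apply: eq_bigr => i _.
  by rewrite mulrACA -exprD subnKC// -ltnS.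
(* Each piece is bounded by one term of the binomial expansion of [((B + B') |c|)^N / N!]: the
   remainder of [f] times the global bound [C'] of [g] gives the term [i = N], and the remainder of
   order [N - i] of [g] gives the term [i]. *)
have -> : f c * g c - \sum_(i < N) s i * c ^+ i * (\sum_(j < N - i) t j * c ^+ j)
  = (f c - \sum_(i < N) s i * c ^+ i) * g c
    + \sum_(i < N) s i * c ^+ i * (g c - \sum_(j < N - i) t j * c ^+ j).
  rewrite mulrBl -addrA; congr (_ + _); rewrite mulr_suml addrC.
  under [X in _ = X - _]eq_bigr do rewrite mulrBr.
  by rewrite sumrB addrAC subrr add0r.
rewrite [X in (X ^+ N)]mulrDl -binomial_fact big_ord_recr/= subnn expr0 fact0 divr1 mulr1 mulrDr addrC.
apply: (le_trans (ler_normD _ _)); apply: lerD.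
  apply: (le_trans (ler_norm_sum _ _ _)); rewrite mulr_sumr; apply: ler_sum => i _.
  rewrite normrM mulrACA; apply: ler_pM => //.
  rewrite normrM normrX exprMn.
  rewrite (_ : C * _ = C * (B ^+ i / i`!%:R) * `|c| ^+ i); last by ring.
    by rewrite ler_wpM2r ?exprn_ge0.
  exact: gB.
by rewrite normrM mulrAC; apply: ler_pM => //; apply: fB.
Qed.

Lemma taylor_entire_weaken (s : nat -> R) (C B C' B' : R) f : 0 <= B -> 0 <= C -> B <= B' -> C <= C' ->
  (forall n, `|s n| <= C * (B ^+ n / n`!%:R)) ->
  (forall N c, `|f c - \sum_(n < N) s n * c ^+ n| <= C * ((B * `|c|) ^+ N / N`!%:R)) ->
  (forall n, `|s n| <= C' * (B' ^+ n / n`!%:R)) /\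
  (forall N c, `|f c - \sum_(n < N) s n * c ^+ n| <= C' * ((B' * `|c|) ^+ N / N`!%:R)).
Proof.
move=> B0 C0 BB CC h1 h2; split=> [n|N c].
  apply: le_trans (h1 n) _; apply: ler_pM => //; first by rewrite divr_ge0 ?exprn_ge0.
  by rewrite ler_wpM2r ?invr_ge0// lerXn2r// ?nnegrE// (le_trans B0).
apply: le_trans (h2 N c) _; apply: ler_pM => //.
  by rewrite divr_ge0 ?exprn_ge0 ?mulr_ge0.
rewrite ler_wpM2r ?invr_ge0// lerXn2r// ?nnegrE ?mulr_ge0//; first exact: le_trans B0 BB.
by rewrite ler_wpM2r.
Qed.

Lemma taylor_entireD f g :
  taylor_entire f -> taylor_entire g -> taylor_entire (fun c => f c + g c).
Proof.
move=> [s [C [B [C0 B0 sB fB]]]] [t [C' [B' [C'0 B'0 tB gB]]]].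
have BM : B <= Num.max B B' by rewrite le_max lexx.
have BM' : B' <= Num.max B B' by rewrite le_max lexx orbT.
have [{}sB {}fB] := taylor_entire_weaken _ _ _ _ _ _ B0 C0 BM (lexx C) sB fB.
have [{}tB {}gB] := taylor_entire_weaken _ _ _ _ _ _ B'0 C'0 BM' (lexx C') tB gB.
exists (fun n => s n + t n), (C + C'), (Num.max B B').
split; [exact: addr_ge0 | by rewrite le_max B0 | move=> n | move=> N c].
  by apply: (le_trans (ler_normD _ _)); rewrite mulrDl lerD.
under eq_bigr do rewrite mulrDl.
rewrite big_split/= opprD addrACA.
apply: (le_trans (ler_normD _ _)); rewrite [leRHS]mulrDl.
by apply: lerD; [exact: fB | exact: gB].
Qed.

Lemma taylor_entire_cst k : taylor_entire (fun=> k : R).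
Proof.
exists (fun n => if n == 0%N then k else 0), `|k|, 0; split => // [[|n]|[|N] c].
- by rewrite expr0 fact0 divr1 mulr1.
- by rewrite normr0 expr0n mul0r mulr0.
- by rewrite big_ord0 subr0 expr0 fact0 divr1 mulr1.
- rewrite big_ord_recl/= expr0 mulr1 big1 ?addr0 ?subrr ?normr0; last by move=> i _; rewrite mul0r.
  by rewrite mul0r expr0n mul0r mulr0.
Qed.

Lemma taylor_entireN f : taylor_entire f -> taylor_entire (fun c => - f c).
Proof.
move=> h; have := taylor_entireM _ _ (taylor_entire_cst (-1)) h.
by congr taylor_entire; apply/funext => c; rewrite mulN1r.
Qed.

Lemma eq0_le_fact_bound (x C y : R) :
  (forall N, `|x| <= C * (y ^+ N / N`!%:R)) -> x = 0.
Proof.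
move=> h; apply/eqP; rewrite -normr_le0.
have e0 : (fun N => C * (y ^+ N / N`!%:R)) @ \oo --> C * 0.
  apply: cvgM; first exact: cvg_cst.
  have := cvg_series_cvg_0 (is_cvg_series_exp_coeff y).
  by congr (_ @ \oo --> _); apply/funext => n; rewrite /exp_coeff.
rewrite mulr0 in e0; rewrite -(cvg_lim _ e0)//.
by apply: limr_ge; [apply/cvg_ex; eexists; exact: e0 | near=> N].
Unshelve. all: by end_near. Qed.

(** Identity theorem by strong induction on the coefficients: if all coefficients below [n] vanish,
    dividing the remainder bound of order [n + 1] by [c^n] leaves [|s n| <= K c], and [c] may be
    taken arbitrarily small. Once all coefficients vanish, the remainder bounds force [f c = 0]. *)
Lemma taylor_entire_eq0 f (r : R) : taylor_entire f -> 0 < r ->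
  (forall c, `|c| <= r -> f c = 0) -> forall c, f c = 0.
Proof.
move=> [s [C [B [C0 B0 sB fB]]]] r0 f0.
suff s0 n : s n = 0.
  move=> c; apply: (@eq0_le_fact_bound _ C (B * `|c|)) => N.
  by have := fB N c; rewrite big1 ?subr0// => i _; rewrite s0 mul0r.
elim/ltn_ind: n => n IH.
set K := C * (B ^+ n.+1 / n.+1`!%:R).
have K0 : 0 <= K by rewrite mulr_ge0// divr_ge0// exprn_ge0.
have H c : 0 < c -> c <= r -> `|s n| <= K * c.
  move=> c0 cr; have := fB n.+1 c.
  have -> : f c = 0 by rewrite f0// gtr0_norm.
  rewrite sub0r normrN big_ord_recr/= big1 ?add0r; last first.
    by move=> i _; rewrite IH// mul0r.
  rewrite normrM normrX (gtr0_norm c0) exprMn.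
  have -> : C * (B ^+ n.+1 * c ^+ n.+1 / n.+1`!%:R) = K * c * c ^+ n.
    by rewrite /K [c ^+ _]exprS; ring.
  by rewrite ler_pM2r// exprn_gt0.
apply/eqP; rewrite -normr_le0; apply/ler_addgt0Pl => e e0; rewrite addr0.
pose c := Num.min r (e / (K + 1)).
have K1 : 0 < K + 1 by rewrite ltr_wpDl.
have c0 : 0 < c by rewrite lt_min r0 divr_gt0.
apply: (le_trans (H c c0 _)); first by rewrite ge_min lexx.
have : c <= e / (K + 1) by rewrite ge_min lexx orbT.
rewrite ler_pdivlMr// mulrDr mulr1 mulrC => h; apply: le_trans h.
by rewrite lerDl ltW.
Qed.

Lemma scaleRE (a b : R) : a *: (b : R^o) = a * b.
Proof. by []. Qed.

Lemma is_derive_le_nonneg (h h' : R -> R) :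
  (forall y : R, is_derive y 1 h (h' y)) -> (forall y, 0 <= y -> 0 <= h' y) ->
  forall y, 0 <= y -> h 0 <= h y.
Proof.
move=> dh h'0 y y0; apply: (@ger0_derive1_ndecry _ h 0) => //.
- by move=> x; rewrite in_itv/= andbT => x0; rewrite derive1E derive_val h'0// ltW.
- apply: continuous_subspaceT => x; apply: differentiable_continuous.
  by apply/derivable1_diffP.
Qed.

Lemma is_derive_exp_sum (k : nat -> R) N (y : R) :
  is_derive y (1 : R) (fun y : R => \sum_(n < N.+1) k n * (y ^+ n / n`!%:R))
    (\sum_(n < N) k n.+1 * (y ^+ n / n`!%:R)).
Proof.
elim: N => [|N IH].
  rewrite big_ord0 (_ : (fun _ => _) = cst (k 0%N)); first exact: is_derive_cst.
  by apply/funext => z; rewrite big_ord1 expr0 fact0 divr1 mulr1.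
rewrite (_ : (fun _ => _) = (fun y => \sum_(n < N.+1) k n * (y ^+ n / n`!%:R))
   + (k N.+1 / N.+1`!%:R) *: (id ^+ N.+1)); last first.
  apply/funext => z; rewrite big_ord_recr/= !fctE; congr (_ + _).
  by rewrite scaleRE mulrA mulrAC.
have dX : is_derive y (1 : R) (id ^+ N.+1 : R -> R) ((N.+1%:R * y ^+ N) *: 1).
  exact: is_deriveX.
have dZ := @is_deriveZ _ _ _ _ (k N.+1 / N.+1`!%:R) _ _ _ dX.
apply: (@is_derive_eq _ _ _ _ _ _ _ _ (is_deriveD IH dZ)).
rewrite [RHS]big_ord_recr/=; congr (_ + _).
rewrite !scaleRE factS natrM mulr1.
have f1 := lt0r_neq0 (fact_gt0R N); have f2 : N.+1%:R != 0 :> R by rewrite pnatr_eq0.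
by move: (N`!%:R) (N.+1%:R) f1 f2 => u v f1 f2; field; rewrite f1 f2.
Qed.

(** Differentiating the cosine shifts its phase by [pi/2]. Hence the remainder of order [N + 1] at
    phase [a] has as derivative the remainder of order [N] at phase [a + pi/2], and induction gives
    the constant 1. The free phase makes the bound cover the sine too. *)
Lemma cos_taylor_bound (a y : R) N :
  `|cos (a + y) - \sum_(n < N) cos (a + n%:R * (pi / 2)) * (y ^+ n / n`!%:R)|
    <= `|y| ^+ N / N`!%:R.
Proof.
(* The monotonicity argument runs on the half-line [0 <= y]; the sign [e] carries the case of
   negative [y], and the induction needs it as a parameter. *)
suff H : forall N (e a y : R), e \in [:: 1; -1] -> 0 <= y ->
  `|cos (a + e * y) - \sum_(n < N) e ^+ n * cos (a + n%:R * (pi / 2)) * (y ^+ n / n`!%:R)|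
    <= y ^+ N / N`!%:R.
  have [y0|y0] := leP 0 y.
    have := H N 1 a y _ y0; rewrite !inE eqxx => /(_ isT); rewrite mul1r.
    by under eq_bigr do rewrite expr1n mul1r; rewrite (ger0_norm y0).
  have := H N (-1) a (- y) _ (ltW _); rewrite oppr_gt0 !inE eqxx orbT => /(_ isT y0).
  rewrite mulrNN mul1r (ltr0_norm y0).
  under eq_bigr => n _.
    rewrite [(-1) ^+ n * _]mulrC -mulrA [(-1) ^+ n * _]mulrA -exprMn mulrNN mul1r; over.
  by [].
elim=> [|{}N IH] e {}a {}y eE y0.
  by rewrite big_ord0 subr0 expr0 fact0 divr1 -[leRHS]/1 ler_norml cos_geN1 cos_le1.
have e2 : e * e = 1 by move: eE; rewrite !inE => /orP[]/eqP->; ring.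
have e1 : `|e| = 1 by move: eE; rewrite !inE => /orP[]/eqP->; rewrite ?normrN normr1.
pose G M (b z : R) := cos (b + e * z) - \sum_(n < M) e ^+ n * cos (b + n%:R * (pi / 2)) * (z ^+ n / n`!%:R).
have dG (z : R) : is_derive z (1 : R) (G N.+1 a) (e * G N (a + pi / 2) z).
  rewrite (_ : G N.+1 a = (cos \o (fun z => a + e * z)) -
     (fun z => \sum_(n < N.+1) e ^+ n * cos (a + n%:R * (pi / 2)) * (z ^+ n / n`!%:R))); last first.
    by apply/funext => u.
  have d1 : is_derive z (1 : R) (fun z => a + e * z) e.
    rewrite (_ : (fun _ => _) = cst a + e *: id); last by apply/funext => u.
    apply: (@is_derive_eq _ _ _ _ _ _ _ _ (is_deriveD (is_derive_cst a z 1) (is_deriveZ e (is_derive_id z 1)))).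
    by rewrite add0r scaleRE mulr1.
  have d2 := is_derive_exp_sum (fun n => e ^+ n * cos (a + n%:R * (pi / 2))) N z.
  have d3 := @is_derive1_comp _ cos _ z _ _ (is_derive_cos (a + e * z)) d1.
  apply: (@is_derive_eq _ _ _ _ _ _ _ _ (is_deriveB d3 d2)).
  rewrite /G mulrBr; congr (_ - _).
    rewrite mulrC; congr (_ * _).
    by rewrite addrAC cosDpihalf.
  rewrite mulr_sumr; apply: eq_bigr => n _.
  rewrite exprS !mulrA; congr (_ * cos _ * _ / _).
  by rewrite -[in LHS]addn1 natrD; field.
have dF (z : R) : is_derive z (1 : R) (fun z : R => z ^+ N.+1 / N.+1`!%:R) (z ^+ N / N`!%:R).
  rewrite (_ : (fun _ => _) = (N.+1`!%:R)^-1 *: (id ^+ N.+1)); last first.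
    by apply/funext => u; rewrite !fctE scaleRE mulrC.
  have dX : is_derive z (1 : R) (id ^+ N.+1 : R -> R) ((N.+1%:R * z ^+ N) *: 1).
    exact: is_deriveX.
  apply: (@is_derive_eq _ _ _ _ _ _ _ _ (is_deriveZ _ dX)).
  rewrite !scaleRE factS natrM mulr1.
  have f1 := lt0r_neq0 (fact_gt0R N); have f2 : N.+1%:R != 0 :> R by rewrite pnatr_eq0.
  by move: (N`!%:R) (N.+1%:R) f1 f2 => u v f1 f2; field; rewrite f1 f2.
have G0 : G N.+1 a 0 = 0.
  rewrite /G mulr0 addr0 big_ord_recl/= big1 ?addr0; last first.
    by move=> i _; rewrite expr0n/= mul0r mulr0.
  by rewrite expr0 mul1r mul0r addr0 expr0 fact0 divr1 mulr1 subrr.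
have Fz : (0 : R) ^+ N.+1 / N.+1`!%:R = 0 by rewrite expr0n mul0r.
have HG z : 0 <= z -> `|e * G N (a + pi / 2) z| <= z ^+ N / N`!%:R.
  by move=> z0; rewrite normrM e1 mul1r; exact: IH.
(* The functions [y^(N+1)/(N+1)! + G] and [y^(N+1)/(N+1)! - G] both vanish at 0 and have nonnegative
   derivative by the induction hypothesis. *)
rewrite -/(G N.+1 a y) ler_norml; apply/andP; split.
  rewrite lerNl -subr_ge0 opprK -(addr0 0) -{1}Fz -{2}G0.
  apply: (@is_derive_le_nonneg (fun y => y ^+ N.+1 / N.+1`!%:R + G N.+1 a y)
     (fun z => z ^+ N / N`!%:R + e * G N (a + pi / 2) z)) => //.
  by move=> z z0; have := HG z z0; rewrite ler_norml => /andP[h _]; lra.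
rewrite -subr_ge0 -(subr0 0) -{1}Fz -{2}G0.
apply: (@is_derive_le_nonneg (fun y => y ^+ N.+1 / N.+1`!%:R - G N.+1 a y)
     (fun z => z ^+ N / N`!%:R - e * G N (a + pi / 2) z)) => //.
by move=> z z0; have := HG z z0; rewrite ler_norml => /andP[_ h]; lra.
Qed.
End TaylorEntire.

(** * The space Rd *)

Section EuclideanSpace.
Context {R : realType}.

Fixpoint addRd (n : nat) : Rd R n -> Rd R n -> Rd R n :=
  match n return Rd R n -> Rd R n -> Rd R n with
  | 0 => fun x _ => x
  | n'.+1 => fun (x y : (Rd R n' * R)%type) =>
      ((addRd n' x.1 y.1, x.2 + y.2) : (Rd R n' * R)%type)
  end.

Fixpoint zeroRd (n : nat) : Rd R n :=
  match n return Rd R n with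
  | 0 => tt
  | n'.+1 => ((zeroRd n', 0) : (Rd R n' * R)%type)
  end.

Fixpoint cube (n : nat) (y : Rd R n) (r : R) : set (Rd R n) :=
  match n return Rd R n -> set (Rd R n) with
  | 0 => fun=> setT
  | n'.+1 => fun (y : (Rd R n' * R)%type) =>
      (cube n' y.1 r `*` `[y.2 - r, y.2 + r] : set (Rd R n' * R)%type)
  end y.

Lemma dotRC n (x y : Rd R n) : dotR x y = dotR y x.
Proof. by elim: n x y => [//|n IH] [x1 x2] [y1 y2] /=; rewrite IH mulrC. Qed.

Lemma dotRDr n (x y z : Rd R n) : dotR x (addRd n y z) = dotR x y + dotR x z.
Proof.
elim: n x y z => [|n IH]; first by move=> *; rewrite addr0.
by move=> [x1 x2] [y1 y2] [z1 z2] /=; rewrite IH mulrDr addrACA.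
Qed.

Lemma dotRDl n (x y z : Rd R n) : dotR (addRd n x y) z = dotR x z + dotR y z.
Proof. by rewrite dotRC dotRDr !(dotRC _ z). Qed.

Lemma dotRZr n t (x y : Rd R n) : dotR x (scaleRd t y) = t * dotR x y.
Proof.
elim: n x y => [|n IH]; first by move=> *; rewrite mulr0.
by move=> [x1 x2] [y1 y2] /=; rewrite IH mulrDr mulrCA.
Qed.

Lemma dotRZl n t (x y : Rd R n) : dotR (scaleRd t x) y = t * dotR x y.
Proof. by rewrite dotRC dotRZr dotRC. Qed.

Lemma dotR0r n (x : Rd R n) : dotR x (zeroRd n) = 0.
Proof. by elim: n x => [//|n IH] [x1 x2] /=; rewrite IH mulr0 addr0. Qed.

Lemma dotR_ge0 n (x : Rd R n) : 0 <= dotR x x.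
Proof.
elim: n x => [//|n IH] [x1 x2] /=.
by rewrite addr_ge0//= -expr2 sqr_ge0.
Qed.

(** Expand the squared lengths of [x + y] and [x - y]. This form without square roots takes the
    place of the Cauchy-Schwarz inequality. *)
Lemma dotR_bound n (x y : Rd R n) : 2 * `|dotR x y| <= dotR x x + dotR y y.
Proof.
have H z : 0 <= dotR x x + dotR y y + 2 * z * dotR x y \/ z ^+ 2 != 1.
  have [z1|] := eqVneq (z ^+ 2) 1; [left|by right].
  have := dotR_ge0 n (addRd n x (scaleRd z y)).
  rewrite dotRDr !dotRDl !dotRZl !dotRZr (dotRC _ y x) mulrA -expr2 z1 mul1r.
  by congr (0 <= _); ring.
have := H 1; have := H (-1); rewrite sqrrN expr1n eqxx.
move=> [h1|//] [h2|//]; rewrite -[2]ger0_norm// -normrM ler_norml; lra.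
Qed.

Lemma measurable_to_Rd0 d (T : measurableType d) (p : T -> Rd R 0) :
  measurable_fun setT p.
Proof.
move=> _ A mA; rewrite setTI.
have [Att|Att] := pselect (A tt).
- rewrite (_ : _ @^-1` _ = setT)//; apply/seteqP; split => // t _.
  by rewrite /preimage/=; case: (p t).
- rewrite (_ : _ @^-1` _ = set0)//; apply/seteqP; split => // t.
  by rewrite /preimage/=; case: (p t).
Qed.

Lemma measurable_dotR d (T : measurableType d) n (f g : T -> Rd R n) :
  measurable_fun setT f -> measurable_fun setT g ->
  measurable_fun setT (fun t => dotR (f t) (g t)).
Proof.
elim: n f g => [|n IH] f g mf mg; first exact: measurable_cst.
have /measurable_fun_pairP[f1 f2] : @measurable_fun _ _ T (Rd R n * R)%type setT f := mf.
have /measurable_fun_pairP[g1 g2] : @measurable_fun _ _ T (Rd R n * R)%type setT g := mg.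
apply: measurable_funD; first exact: IH f1 g1.
exact: measurable_funM f2 g2.
Qed.

(** The coordinates are among the linear forms. The source is arbitrary because the lemma is also
    applied to a sigma-algebra built from multipliers, in [exp_module_indic]. *)
Lemma measurable_to_Rd d (T : measurableType d) n (p : T -> Rd R n) :
  (forall y, measurable_fun setT (fun t => dotR (p t) y)) -> measurable_fun setT p.
Proof.
elim: n p => [|n IH] p mp; first exact: measurable_to_Rd0.
suff : @measurable_fun _ _ T (Rd R n * R)%type setT p by [].
apply/measurable_fun_pairP; split.
  apply: IH => y.
  have := mp ((y, 0) : (Rd R n * R)%type).
  by congr measurable_fun; apply/funext => t /=; rewrite mulr0 addr0.
have := mp ((zeroRd n, 1) : (Rd R n * R)%type).
by congr measurable_fun; apply/funext => t /=; rewrite dotR0r mulr1 add0r.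
Qed.

Lemma measurable_scaleRd d (T : measurableType d) n (f : T -> R) (g : T -> Rd R n) :
  measurable_fun setT f -> measurable_fun setT g ->
  measurable_fun setT (fun t => scaleRd (f t) (g t)).
Proof.
move=> mf mg; apply: measurable_to_Rd => y.
under eq_fun do rewrite dotRZl.
apply: measurable_funM => //; apply: measurable_dotR => //.
Qed.

Lemma measurable_normalize n : measurable_fun setT (@normalize R n).
Proof.
apply: measurable_scaleRd; last exact: measurable_id.
rewrite (_ : (fun _ => _) = (@powR R)^~ (- 2^-1) \o (fun x => dotR x x)); last first.
  by apply/funext => x /=; rewrite powRN powR12_sqrt// dotR_ge0.
apply: measurableT_comp; first exact: measurable_powR.
by apply: measurable_dotR; exact: measurable_id.
Qed.

Lemma measurable_cube n (y : Rd R n) r : measurable (cube n y r).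
Proof.
elim: n y => [//|n IH] [y1 y2].
by apply: (@measurableX _ _ (Rd R n) R); [exact: IH | exact: measurable_itv].
Qed.

Lemma leb_cube n (y : Rd R n) r : 0 <= r -> leb R n (cube n y r) = ((2 * r) ^+ n)%:E.
Proof.
move=> r0; elim: n y => [|n IH] y.
  by rewrite expr0 -[LHS]/(@dirac _ unit tt R setT) diracE mem_set.
case: y => y1 y2.
transitivity ((leb R n \x lebesgue_measure)%E (cube n y1 r `*` `[y2 - r, y2 + r])) => //.
rewrite product_measure1E; [|exact: measurable_cube|exact: measurable_itv].
have L : lebesgue_measure (`[y2 - r, y2 + r]%classic : set R) = (2 * r)%:E.
  rewrite lebesgue_measure_itv/= lte_fin.
  have [r1|] := ltP (y2 - r) (y2 + r); first by rewrite -EFinB; congr EFin; ring.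
  by move=> h; congr EFin; lra.
by rewrite IH -[X in (_ * X)%E]/(lebesgue_measure (`[y2 - r, y2 + r]%classic : set R)) L -EFinM exprSr.
Qed.

Lemma cube_cover n (x : Rd R n) r : dotR x x <= r ^+ 2 -> 0 <= r -> cube n (zeroRd n) r x.
Proof.
elim: n x => [//|n IH] [x1 x2] /= h r0; split => /=.
  by apply: IH => //; apply: le_trans h; rewrite lerDl -expr2 sqr_ge0.
have {}h : x2 ^+ 2 <= r ^+ 2.
  by apply: le_trans h; rewrite -expr2 lerDr dotR_ge0.
rewrite in_itv/= !add0r -ler_norml -(ger0_norm r0).
by rewrite -ler_sqr ?nnegrE// !real_normK ?num_real.
Qed.

Lemma cube_exhaust n (x : Rd R n) :
  exists K, forall k : nat, (K <= k)%N -> cube n (zeroRd n) k%:R x.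
Proof.
exists (Num.bound (dotR x x)) => k Kk; apply: cube_cover => //.
apply: le_trans (ltW (archi_boundP (dotR_ge0 _ x))) _.
rewrite -natrX ler_nat; apply: (leq_trans Kk).
by case: k {Kk} => // k; rewrite expnS leq_pmulr.
Qed.

Lemma leb_sigma_finite n : sigma_finite setT (leb R n).
Proof.
exists (fun k => cube n (zeroRd n) k%:R).
  apply/seteqP; split => // x _.
  by have [K h] := cube_exhaust n x; exists K => //; exact: h.
move=> i; split; first exact: measurable_cube.
by rewrite leb_cube// ltry.
Qed.

(* A copy of leb carrying the sigma-finite structure required by Fubini. *)
Definition leb_fun n : set (Rd R n) -> \bar R := leb R n.

HB.instance Definition _ n := Measure.copy (leb_fun n) (leb R n).

HB.instance Definition _ n :=
  @Measure_isSigmaFinite.Build _ _ _ (leb_fun n) (leb_sigma_finite n).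

Definition sleb n : {sigma_finite_measure set Rd R n -> \bar R} := leb_fun n.

End EuclideanSpace.

(** * Modules over the characters *)

Section Steps.
Context {R : realType}.
Implicit Types p q u : R.

Lemma bernoulli_le u m : 0 <= u -> 1 + m%:R * u <= (1 + u) ^+ m.
Proof.
move=> u0; elim: m => [|m IH]; first by rewrite mul0r addr0 expr0.
rewrite exprS; apply: (@le_trans _ _ ((1 + u) * (1 + m%:R * u))).
  have : 0 <= m%:R * u * u by rewrite !mulr_ge0.
  by rewrite -(addn1 m) natrD; lra.
by rewrite ler_wpM2l// addr_ge0.
Qed.

Lemma bernoulli_ge u m : 0 <= u <= 1 -> 1 - m%:R * u <= (1 - u) ^+ m.
Proof.
move=> /andP[u0 u1]; elim: m => [|m IH]; first by rewrite mul0r subr0 expr0.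
rewrite exprS; apply: (@le_trans _ _ ((1 - u) * (1 - m%:R * u))).
  have : 0 <= m%:R * u * u by rewrite !mulr_ge0.
  by rewrite -(addn1 m) natrD; lra.
by rewrite ler_wpM2l// subr_ge0.
Qed.

Lemma cvg_natr_geometric q : 0 <= q < 1 -> (fun k => k%:R * q ^+ k) @ \oo --> (0 : R).
Proof.
move=> /andP[]; rewrite le_eqVlt => /predU1P[<- _|q0 q1].
  apply: cvg_near_cst; near=> k.
  have k0 : (0 < k)%N by near: k; exact: nbhs_infty_gt.
  by rewrite expr0n eqn0Ngt k0 mulr0.
(* With [q = r^2], Bernoulli's inequality for [r^-1 = 1 + t] bounds [k r^k] by [t^-1], so [k q^k] is
   at most [t^-1 r^k]. *)
pose r := Num.sqrt q.
have r0 : 0 < r by rewrite sqrtr_gt0.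
have r1 : r < 1 by rewrite -sqrtr1 ltr_sqrt.
have rq : q = r * r by rewrite -expr2 sqr_sqrtr// ltW.
pose t := r^-1 - 1.
have t0 : 0 < t by rewrite subr_gt0 invf_gt1.
apply: (@squeeze_cvgr _ _ _ _ (cst 0) (fun k => t^-1 * r ^+ k) _).
- near=> k; rewrite mulr_ge0 ?exprn_ge0 ?(ltW q0)//=.
  rewrite rq exprMn mulrA ler_wpM2r ?exprn_ge0 ?(ltW r0)//.
  have := @bernoulli_le t k (ltW t0).
  have -> : 1 + t = r^-1 by rewrite /t; ring.
  have rk : 0 < r ^+ k by rewrite exprn_gt0.
  rewrite exprVn -div1r ler_pdivlMr// => h.
  by rewrite -(ler_pM2r t0) mulVf ?gt_eqF//; nra.
- exact: cvg_cst.
- rewrite -[X in _ --> X](mulr0 t^-1); apply: cvgM; first exact: cvg_cst.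
  by apply: cvg_expr; rewrite gtr0_norm.
Unshelve. all: by end_near. Qed.

(* These polynomials in p converge on [0, 1] to the indicator of p < 1/2; the
   factor k in the exponent makes the limit 0 also at p = 1/2. *)
Definition step_seq p k := (1 - p ^+ k) ^+ (k * 2 ^ k).

Lemma step_seq01 p k : 0 <= p <= 1 -> 0 <= step_seq p k <= 1.
Proof.
move=> /andP[p0 p1].
have h0 : 0 <= 1 - p ^+ k by rewrite subr_ge0 exprn_ile1.
by rewrite exprn_ge0//= exprn_ile1// gerBl exprn_ge0.
Qed.

(** For [p < 1/2], Bernoulli gives the lower bound [1 - k (2p)^k]. For [p >= 1/2], multiply by
    [(1 + p^k)^(k 2^k)]: the product is at most 1, while the factor is at least
    [1 + k (2p)^k >= k + 1], so the harmonic sequence dominates. *)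
Lemma step_seq_cvg p : 0 <= p <= 1 -> step_seq p @ \oo --> ((p < 2^-1)%R%:R : R).
Proof.
move=> /andP[p0 p1]; have [pl|pl] := ltP p 2^-1.
  apply: (@squeeze_cvgr _ _ _ _ (fun k => 1 - k%:R * (2 * p) ^+ k) (cst 1) _).
  - near=> k; have /andP[_ ->] : 0 <= step_seq p k <= 1 by rewrite step_seq01// p0.
    rewrite andbT; have := @bernoulli_ge (p ^+ k) (k * 2 ^ k).
    by rewrite exprn_ge0// exprn_ile1// natrM natrX exprMn mulrA => ->.
  - rewrite -[X in _ --> X](subr0 1); apply: cvgB; first exact: cvg_cst.
    by apply: cvg_natr_geometric; rewrite mulr_ge0//= -ltr_pdivlMl// mulr1.
  - exact: cvg_cst.
apply: (@squeeze_cvgr _ _ _ _ (cst 0) (@harmonic R) _).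
- near=> k; have /andP[-> _] /= : 0 <= step_seq p k <= 1 by rewrite step_seq01// p0.
  have pk0 : 0 <= p ^+ k by rewrite exprn_ge0.
  have h0 : 0 <= 1 - p ^+ k by rewrite subr_ge0 exprn_ile1.
  rewrite /harmonic -div1r ler_pdivlMr ?ltr0n//.
  apply: (@le_trans _ _ (step_seq p k * (1 + p ^+ k) ^+ (k * 2 ^ k))).
    rewrite ler_wpM2l ?exprn_ge0//; apply: le_trans (@bernoulli_le (p ^+ k) _ pk0).
    rewrite -natr1 addrC lerD2l natrM -mulrA ler_peMr//.
    by rewrite natrX -exprMn exprn_ege1// -ler_pdivrMl// mulr1.
  by rewrite /step_seq -exprMn -subr_sqr expr1n exprn_ile1// ?subr_ge0 ?gerBl ?exprn_ile1 ?exprn_ge0.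
- exact: cvg_cst.
- exact: cvg_harmonic.
Unshelve. all: by end_near. Qed.
End Steps.

Section Multipliers.
Context {R : realType} {n : nat}.
Notation T := (Rd R n).
Notation mu := (leb R n).
Implicit Types (b w : T -> R) (x y : T).

Definition intg b := mu.-integrable setT (EFin \o b).

Lemma intg_measurable b : intg b -> measurable_fun setT b.
Proof. by move=> /measurable_int/measurable_EFinP. Qed.

Lemma intgD b b' : intg b -> intg b' -> intg (fun x => b x + b' x).
Proof. by move=> h h'; have := integrableD measurableT h h'. Qed.

Lemma intgZ k b : intg b -> intg (fun x => k * b x).
Proof. by move=> h; have := integrableZl measurableT k h. Qed.

Lemma intg_le b b' : measurable_fun setT b -> intg b' ->
  (forall x, `|b x| <= `|b' x|) -> intg b.
Proof.
move=> mb ib' h; apply: (le_integrable measurableT _ _ ib'); first exact/measurable_EFinP.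
by move=> x _; rewrite /= lee_fin.
Qed.

Lemma intgM b w : intg b -> measurable_fun setT w -> (forall x, `|w x| <= 1) ->
  intg (fun x => b x * w x).
Proof.
move=> ib mw w1; apply: (intg_le _ b _ ib); last by move=> x; rewrite normrM ler_piMr.
by apply: measurable_funM => //; exact: intg_measurable.
Qed.

Lemma intg_indic (A : set T) : measurable A -> (mu A < +oo)%E -> intg (\1_A).
Proof.
move=> mA Aoo; apply/integrableP; split; first exact/measurable_EFinP.
rewrite (eq_integral (fun x => (\1_A x)%:E)).
  by rewrite integral_indic// setIT.
by move=> x _; rewrite gee0_abs// lee_fin.
Qed.

Lemma measurable_dotRl y : measurable_fun setT (fun x : T => dotR x y).
Proof. by apply: measurable_dotR => //; exact: measurable_cst. Qed.

Lemma measurable_cosR d (X : measurableType d) (f : X -> R) :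
  measurable_fun setT f -> measurable_fun setT (fun t => cos (f t)).
Proof.
move=> mf; apply: (@measurableT_comp _ _ _ _ _ _ cos) => //.
by apply: continuous_measurable_fun; exact: continuous_cos.
Qed.

Lemma measurable_sinR d (X : measurableType d) (f : X -> R) :
  measurable_fun setT f -> measurable_fun setT (fun t => sin (f t)).
Proof.
move=> mf; apply: (@measurableT_comp _ _ _ _ _ _ sin) => //.
by apply: continuous_measurable_fun; exact: continuous_sin.
Qed.

Lemma intg_cos b y : intg b -> intg (fun x => b x * cos (dotR x y)).
Proof.
move=> ib; apply: intgM => //; last by move=> x; exact: cos_max.
exact/measurable_cosR/measurable_dotRl.
Qed.

Lemma intg_sin b y : intg b -> intg (fun x => b x * sin (dotR x y)).
Proof.
move=> ib; apply: intgM => //; last by move=> x; exact: sin_max.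
exact/measurable_sinR/measurable_dotRl.
Qed.

(* Such a V is automatically stable under multiplication by indicators of
   measurable sets (exp_module_indic); this yields both the injectivity of the
   Fourier transform and the Riemann-Lebesgue lemma. *)
Record exp_module (V : set (T -> R)) : Prop := ExpModule {
  em_intg : forall b, V b -> intg b ;
  em_add : forall b b', V b -> V b' -> V (fun x => b x + b' x) ;
  em_scale : forall k b, V b -> V (fun x => k * b x) ;
  em_cos : forall b y, V b -> V (fun x => b x * cos (dotR x y)) ;
  em_sin : forall b y, V b -> V (fun x => b x * sin (dotR x y)) ;
  em_dominated : forall (b_ : nat -> T -> R) b g, (forall k, V (b_ k)) -> intg g ->
    (forall k x, `|b_ k x| <= g x) -> (forall x, b_ ^~ x @ \oo --> b x) -> V b }.

Section ExpModule.
Variables (V : set (T -> R)) (emV : exp_module V).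

Let mult w := forall b, V b -> V (fun x => b x * w x).

Let multM w w' : mult w -> mult w' -> mult (fun x => w x * w' x).
Proof.
move=> h h' b Vb; have := h' _ (h _ Vb).
by congr V; apply/funext => x; rewrite mulrA.
Qed.

Let multD w w' : mult w -> mult w' -> mult (fun x => w x + w' x).
Proof.
move=> h h' b Vb; have := em_add _ emV _ _ (h _ Vb) (h' _ Vb).
by congr V; apply/funext => x; rewrite mulrDr.
Qed.

Let mult_cst k : mult (fun=> k).
Proof.
move=> b Vb; have := em_scale _ emV k _ Vb.
by congr V; apply/funext => x; rewrite mulrC.
Qed.

Let multX w k : mult w -> mult (fun x => w x ^+ k).
Proof.
move=> h; elim: k => [|k IH]; first exact: (mult_cst 1).
have := multM _ _ h IH; by congr mult; apply/funext => x; rewrite exprS.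
Qed.

Let mult1B w : mult w -> mult (fun x => 1 - w x).
Proof.
move=> h; have := multD _ _ (mult_cst 1) (multM _ _ (mult_cst (-1)) h).
by congr mult; apply/funext => x; rewrite mulN1r.
Qed.

Let mult_lim (w_ : nat -> T -> R) w : (forall k, mult (w_ k)) ->
  (forall k x, `|w_ k x| <= 1) -> (forall x, w_ ^~ x @ \oo --> w x) -> mult w.
Proof.
move=> mw w1 ww b Vb.
apply: (em_dominated _ emV (fun k x => b x * w_ k x) _ (fun x => `|b x|)).
- by move=> k; exact: mw.
- by apply: integrable_norm; exact: em_intg _ emV _ Vb.
- by move=> k x; rewrite normrM ler_piMr.
- by move=> x; apply: cvgM; [exact: cvg_cst | exact: ww].
Qed.

Let multset (A : set T) := mult (\1_A : T -> R).

Let multset_sin y (al : R) : multset [set x | sin (dotR x y + al) < 0].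
Proof.
(* The sine is rescaled to [[0, 1]] so that its negative values correspond exactly to [p x < 1/2].
   The polynomials [step_seq] in [p] are multipliers and converge boundedly to the indicator. *)
pose p x := (1 + sin (dotR x y + al)) / 2.
have p01 x : 0 <= p x <= 1.
  by rewrite /p; have := sin_max (dotR x y + al); rewrite ler_norml => /andP[]; lra.
apply: (mult_lim (fun k x => step_seq (p x) k)).
- move=> k; apply: multX; apply: mult1B; apply: multX.
  apply: multM; last exact: mult_cst.
  apply: multD; first exact: mult_cst.
  have h1 : mult (fun x => sin (dotR x y) * cos al).
    by apply: multM; [move=> b; exact: em_sin | exact: mult_cst].
  have h2 : mult (fun x => cos (dotR x y) * sin al).
    by apply: multM; [move=> b; exact: em_cos | exact: mult_cst].
  by have := multD _ _ h1 h2; congr mult; apply/funext => x; rewrite sinD.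
- by move=> k x; have /andP[h1 h2] := step_seq01 (p x) k (p01 x); rewrite ger0_norm.
- move=> x; rewrite indicE; have := step_seq_cvg (p x) (p01 x).
  congr (_ @ \oo --> _); congr (nat_of_bool _)%:R.
  have -> : (p x < 2^-1) = (sin (dotR x y + al) < 0).
    by rewrite /p -[ltRHS]mul1r ltr_pM2r ?invr_gt0// gtrDl.
  by apply/idP/idP => [h|/set_mem//]; exact: mem_set.
Qed.

Let sigma_multset : sigma_algebra setT multset.
Proof.
have multI A B : multset A -> multset B -> multset (A `&` B).
  by move=> mA mB; have := multM _ _ mA mB; congr mult; rewrite indicI.
have multC A : multset A -> multset (~` A).
  move=> mA; have := mult1B _ mA; congr mult; apply/funext => x.
  by rewrite !indicE in_setC; case: (_ \in _); rewrite /= ?subrr ?subr0.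
split; first by rewrite /multset indic0; exact: (mult_cst 0).
  by move=> A mA; rewrite setTD; exact: multC.
move=> A mA.
have mU k : multset (\big[setU/set0]_(i < k) A i).
  elim: k => [|k IH]; first by rewrite big_ord0 /multset indic0; exact: (mult_cst 0).
  by rewrite big_ord_recr/= -[X in multset X]setCK setCU; apply: (multC); apply: multI; apply: (multC).
apply: (mult_lim (fun k => \1_(\big[setU/set0]_(i < k) A i))) => //.
  by move=> k x; rewrite indicE; case: (_ \in _); rewrite ?normr1 ?normr0.
move=> x; apply: cvg_near_cst; rewrite indicE.
have [[i _ Aix]|nAx] := pselect ((\bigcup_k A k) x).
  near=> k; rewrite indicE mem_set; last first.
    rewrite -bigcup_mkord; exists i => //=; near: k; exact: nbhs_infty_gt.
  by rewrite mem_set//; exists i.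
near=> k; rewrite indicE memNset; last first.
  by rewrite -bigcup_mkord => -[j _ Ajx]; apply: nAx; exists j.
by rewrite memNset.
Unshelve. all: by end_near. Qed.

(** The sets whose indicators act on [V] form a sigma-algebra. It contains every measurable set as
    soon as the identity is measurable from it, and this is tested on linear forms, that is, on
    half-spaces. *)
Lemma exp_module_indic (A : set T) b : measurable A -> V b -> V (fun x => b x * \1_A x).
Proof.
move=> mA; suff : multset A by exact.
pose T' := g_sigma_algebraType multset.
suff mid : @measurable_fun _ _ T' T setT id.
  have := mid measurableT _ mA; rewrite setTI.
  by rewrite -[X in _ -> X A](sigma_algebra_id sigma_multset).
apply: measurable_to_Rd => y.
apply: (measurability _ (RGenInftyO.measurableE R)) => _ [_ [al ->] <-]; rewrite setTI.
(* The half-space is the lower limit of the sets [S k]: for large [k] the argument of the sine lies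
   in [[-1, 1]], where the sine has the sign of [dotR x y - al]. *)
pose S k := [set x | sin (dotR x (scaleRd k.+1%:R^-1 y) + (- al / k.+1%:R)) < 0].
have mS k : measurable (S k : set T') by apply: sub_sigma_algebra; exact: multset_sin.
have SE k x : S k x <-> sin ((dotR x y - al) / k.+1%:R) < 0.
  by rewrite /S /= dotRZr [X in _ + X]mulrC [X in _ <-> is_true (sin X < _)]mulrC mulrDr mulrN [X in _ - X]mulrC.
rewrite (_ : _ @^-1` _ = \bigcup_m \bigcap_(k in [set k | (m <= k)%N]) S k); last first.
  apply/seteqP; split => [x /=|x [m _ Sx]/=]; rewrite in_itv/=.
    move=> xal; pose u := al - dotR x y.
    have u0 : 0 < u by rewrite subr_gt0.
    exists (Num.bound u) => // k /= ku; apply/SE.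
    rewrite -opprB -/u mulNr sinN oppr_lt0 sin_gt0_pi// divr_gt0//=.
    apply: (@lt_le_trans _ _ 1).
      rewrite ltr_pdivrMr// mul1r; apply: lt_le_trans (archi_boundP (ltW u0)) _.
      by rewrite ler_nat ltnW.
    by have := pi_ge2 R; lra.
  rewrite ltNge; apply/negP => xal; pose u := dotR x y - al.
  have u0 : 0 <= u by rewrite subr_ge0.
  pose k := maxn m (Num.bound u).
  have /SE := Sx k (leq_maxl _ _); rewrite ltNge => /negP; apply.
  rewrite -/u sin_ge0_pi// divr_ge0//=.
  apply: (@le_trans _ _ 1); last by have := pi_ge2 R; lra.
  rewrite ler_pdivrMr// mul1r; apply: ltW; apply: lt_le_trans (archi_boundP u0) _.
  by rewrite ler_nat ltnW// ltnS leq_maxr.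
apply: bigcup_measurable => m _; apply: bigcap_measurable => //.
by exists m => /=.
Qed.

End ExpModule.
End Multipliers.

(** * The Fourier transform *)

Section RintegralDominated.
Context d (X : measurableType d) (R : realType) (mu : {measure set X -> \bar R}).

Lemma Rintegral_dominated (f_ : nat -> X -> R) (f g : X -> R) :
  (forall k, measurable_fun setT (f_ k)) ->
  mu.-integrable setT (EFin \o g) -> (forall k x, `|f_ k x| <= g x) ->
  (forall x, f_ ^~ x @ \oo --> f x) ->
  [/\ mu.-integrable setT (EFin \o f),
      (fun k => \int[mu]_x `|f_ k x - f x|) @ \oo --> (0 : R) &
      (fun k => \int[mu]_x f_ k x) @ \oo --> \int[mu]_x f x].
Proof.
move=> mf_ ig fg ff.
have mf : measurable_fun setT f.
  by apply: (measurable_fun_cvg mf_) => x _; exact: ff.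
have [||||| i1 i2 i3] := @dominated_convergence _ _ _ mu setT measurableT
  (fun k => EFin \o f_ k) (EFin \o f) (EFin \o g).
- by move=> k; exact/measurable_EFinP.
- exact/measurable_EFinP.
- by apply: aeW => x _; apply: cvg_EFin; [near=> k | exact: ff].
- exact: ig.
- by apply: aeW => x k _; rewrite lee_fin.
have iB k : mu.-integrable setT (EFin \o (fun x => f_ k x - f x)).
  have ik : mu.-integrable setT (EFin \o f_ k).
    apply: (le_integrable measurableT _ _ ig); first exact/measurable_EFinP.
    by move=> x _; rewrite lee_fin (le_trans (fg k x))// ler_norm.
  exact: (integrableB measurableT ik i1).
split => //.
- exact: (fine_cvg i2).
- have fin : (\int[mu]_x (f x)%:E)%E \is a fin_num by exact: integrable_fin_num.
  by apply: fine_cvg; rewrite fineK.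
Unshelve. all: by end_near. Qed.

End RintegralDominated.

Import HBNNSimple.

Section FourierTransform.
Context {R : realType} {n : nat}.
Notation T := (Rd R n).
Notation mu := (leb R n).
Implicit Types (b w : T -> R) (x y z : T).

Definition FC b y := \int[mu]_x (b x * cos (dotR x y)).
Definition FS b y := \int[mu]_x (b x * sin (dotR x y)).

Lemma FC_ext b y z : (forall x, dotR x y = dotR x z) -> FC b y = FC b z.
Proof. by move=> h; congr Rintegral; apply/funext => x; rewrite h. Qed.

Lemma FS_ext b y z : (forall x, dotR x y = dotR x z) -> FS b y = FS b z.
Proof. by move=> h; congr Rintegral; apply/funext => x; rewrite h. Qed.

Lemma FCD b b' y : intg b -> intg b' -> FC (fun x => b x + b' x) y = FC b y + FC b' y.
Proof.
move=> ib ib'; rewrite -RintegralD//; [|exact: intg_cos|exact: intg_cos].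
by congr Rintegral; apply/funext => x; rewrite mulrDl.
Qed.

Lemma FSD b b' y : intg b -> intg b' -> FS (fun x => b x + b' x) y = FS b y + FS b' y.
Proof.
move=> ib ib'; rewrite -RintegralD//; [|exact: intg_sin|exact: intg_sin].
by congr Rintegral; apply/funext => x; rewrite mulrDl.
Qed.

Lemma FCZ k b y : intg b -> FC (fun x => k * b x) y = k * FC b y.
Proof.
move=> ib; rewrite -RintegralZl//; last exact: intg_cos.
by congr Rintegral; apply/funext => x; rewrite mulrA.
Qed.

Lemma FSZ k b y : intg b -> FS (fun x => k * b x) y = k * FS b y.
Proof.
move=> ib; rewrite -RintegralZl//; last exact: intg_sin.
by congr Rintegral; apply/funext => x; rewrite mulrA.
Qed.

Definition oppRd y := scaleRd (-1) y.

Lemma dotRNr x y : dotR x (oppRd y) = - dotR x y.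
Proof. by rewrite dotRZr mulN1r. Qed.

Let half_sum (f g h : T -> R) : intg f -> intg g ->
  (forall x, h x = (f x + g x) / 2) ->
  \int[mu]_x h x = (\int[mu]_x f x + \int[mu]_x g x) / 2.
Proof.
move=> fi gi hE; rewrite -RintegralD// -RintegralZr//; last exact: intgD.
by congr Rintegral; apply/funext => x.
Qed.

Let intgN b : intg b -> intg (fun x => - b x).
Proof. by move=> /(intgZ (-1)); congr intg; apply/funext => x; rewrite mulN1r. Qed.

Let RintN b : intg b -> \int[mu]_x (- b x) = - \int[mu]_x b x.
Proof.
move=> ib; rewrite -mulN1r -RintegralZl//.
by congr Rintegral; apply/funext => x; rewrite mulN1r.
Qed.

Lemma FC_mul_cos b y z : intg b ->
  FC (fun x => b x * cos (dotR x z)) y = (FC b (addRd n y z) + FC b (addRd n y (oppRd z))) / 2.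
Proof.
move=> ib; apply: half_sum; [exact: intg_cos|exact: intg_cos|move=> x].
by rewrite !dotRDr dotRNr !cosD cosN sinN; field.
Qed.

Lemma FS_mul_cos b y z : intg b ->
  FS (fun x => b x * cos (dotR x z)) y = (FS b (addRd n y z) + FS b (addRd n y (oppRd z))) / 2.
Proof.
move=> ib; apply: half_sum; [exact: intg_sin|exact: intg_sin|move=> x].
by rewrite !dotRDr dotRNr !sinD cosN sinN; field.
Qed.

Lemma FC_mul_sin b y z : intg b ->
  FC (fun x => b x * sin (dotR x z)) y = (FS b (addRd n y z) - FS b (addRd n y (oppRd z))) / 2.
Proof.
move=> ib; rewrite -RintN; last exact: intg_sin.
apply: half_sum; [exact: intg_sin|by apply: intgN; exact: intg_sin|move=> x].
by rewrite !dotRDr dotRNr !sinD cosN sinN; field.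
Qed.

Lemma FS_mul_sin b y z : intg b ->
  FS (fun x => b x * sin (dotR x z)) y = (FC b (addRd n y (oppRd z)) - FC b (addRd n y z)) / 2.
Proof.
move=> ib; rewrite -RintN; last exact: intg_cos.
apply: half_sum; [exact: intg_cos|by apply: intgN; exact: intg_cos|move=> x].
by rewrite !dotRDr dotRNr !cosD cosN sinN; field.
Qed.

(* For v = 0 this says that the Fourier transform of b vanishes identically. *)
Definition decay (v : T) : set (T -> R) := [set b | intg b /\ forall y,
  (fun k : nat => FC b (addRd n y (scaleRd k%:R v))) @ \oo --> (0 : R) /\
  (fun k : nat => FS b (addRd n y (scaleRd k%:R v))) @ \oo --> (0 : R)].

Let le_diff (c : T -> R) b b' : intg b -> intg b' -> measurable_fun setT c ->
  (forall x, `|c x| <= 1) ->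
  `|\int[mu]_x (b' x * c x)| <= `|\int[mu]_x (b x * c x)| + \int[mu]_x `|b x - b' x|.
Proof.
move=> ib ib' mc c1.
have ibc : intg (fun x => b x * c x) by exact: intgM.
have ibc' : intg (fun x => b' x * c x) by exact: intgM.
have iB : intg (fun x => b x - b' x) by apply: intgD => //; exact: intgN.
have -> : \int[mu]_x (b' x * c x) = \int[mu]_x (b x * c x) - \int[mu]_x ((b x - b' x) * c x).
  rewrite -RintegralB//; last exact: intgM.
  by congr Rintegral; apply/funext => x; ring.
apply: (le_trans (ler_normB _ _)); rewrite lerD2l.
have iBc : intg (fun x => (b x - b' x) * c x) by exact: intgM.
apply: (le_trans (le_normr_Rintegral measurableT iBc)).
apply: le_Rintegral => //; [exact: integrable_norm|exact: integrable_norm|].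
by move=> x _; rewrite normrM ler_piMr.
Qed.

Let cvg0_approx (u : nat -> R) (e : nat -> R) (w : nat -> nat -> R) :
  e @ \oo --> (0 : R) -> (forall k, w k @ \oo --> (0 : R)) ->
  (forall k j, `|u j| <= `|w k j| + e k) -> u @ \oo --> (0 : R).
Proof.
move=> e0 w0 h; apply/cvgr0Pnorm_lt => eps eps0.
have e2 : 0 < eps / 2 by rewrite divr_gt0.
have /cvgr0Pnorm_lt/(_ _ e2)[k _ ek] := e0.
have /cvgr0Pnorm_lt/(_ _ e2) := w0 k; apply: filterS => j wj.
apply: (le_lt_trans (h k j)); rewrite [eps]splitr ltrD//.
by apply: le_lt_trans (ek k _) => //=; exact: ler_norm.
Qed.

(** Multiplying by a character translates the frequency, which is why [decay] quantifies over every
    base point [y]. Dominated limits are allowed because the transforms of two functions differ by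
    at most their [L1] distance, uniformly in the frequency. *)
Lemma exp_module_decay v : exp_module (decay v).
Proof.
have AC y z k x : dotR x (addRd n (addRd n y (scaleRd k v)) z) = dotR x (addRd n (addRd n y z) (scaleRd k v)).
  by rewrite !dotRDr addrAC.
split.
- by move=> b [].
- move=> b b' [ib hb] [ib' hb']; split=> [|y]; first exact: intgD.
  have [h1 h2] := hb y; have [h1' h2'] := hb' y; split.
    by under eq_fun do rewrite FCD//; rewrite -[0 : R]addr0; exact: cvgD.
  by under eq_fun do rewrite FSD//; rewrite -[0 : R]addr0; exact: cvgD.
- move=> k b [ib hb]; split=> [|y]; first exact: intgZ.
  have [h1 h2] := hb y; split.
    by under eq_fun do rewrite FCZ//; rewrite -[0 : R](mulr0 k); exact: cvgMr.
  by under eq_fun do rewrite FSZ//; rewrite -[0 : R](mulr0 k); exact: cvgMr.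
- move=> b z [ib hb]; split=> [|y]; first exact: intg_cos.
  have [h1 h2] := hb (addRd n y z); have [h1' h2'] := hb (addRd n y (oppRd z)).
  have E0 : 0 = (0 + 0) / 2 :> R by rewrite addr0 mul0r.
  split.
    under eq_fun do rewrite FC_mul_cos// !(FC_ext _ _ _ (AC _ _ _)).
    by rewrite E0; apply: cvgMl; exact: cvgD.
  under eq_fun do rewrite FS_mul_cos// !(FS_ext _ _ _ (AC _ _ _)).
  by rewrite E0; apply: cvgMl; exact: cvgD.
- move=> b z [ib hb]; split=> [|y]; first exact: intg_sin.
  have [h1 h2] := hb (addRd n y z); have [h1' h2'] := hb (addRd n y (oppRd z)).
  have E0 : 0 = (0 - 0) / 2 :> R by rewrite subr0 mul0r.
  split.
    under eq_fun do rewrite FC_mul_sin// !(FS_ext _ _ _ (AC _ _ _)).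
    by rewrite E0; apply: cvgMl; exact: cvgB.
  under eq_fun do rewrite FS_mul_sin// !(FC_ext _ _ _ (AC _ _ _)).
  by rewrite E0; apply: cvgMl; exact: cvgB.
- move=> b_ b g hb ig bg bb.
  have [|ib e0 _] := Rintegral_dominated _ _ _ mu b_ b g _ ig bg bb.
    by move=> k; apply: intg_measurable; have [] := hb k.
  split => // y; split.
    apply: (cvg0_approx _ _ (fun k j => FC (b_ k) (addRd n y (scaleRd j%:R v))) e0).
      by move=> k; have [_ /(_ y)[]] := hb k.
    move=> k j; apply: le_diff => //; first by have [] := hb k.
      exact/measurable_cosR/measurable_dotRl.
    by move=> x; exact: cos_max.
  apply: (cvg0_approx _ _ (fun k j => FS (b_ k) (addRd n y (scaleRd j%:R v))) e0).
    by move=> k; have [_ /(_ y)[]] := hb k.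
  move=> k j; apply: le_diff => //; first by have [] := hb k.
    exact/measurable_sinR/measurable_dotRl.
  by move=> x; exact: sin_max.
Qed.

(** Take [v = 0], so that the frequencies do not move. The module property passes the vanishing from
    [b] to its restriction to any measurable [E], and at frequency 0 this reads that the integral of
    [b] over [E] is 0. *)
Lemma fourier_injective b : intg b -> (forall y, FC b y = 0 /\ FS b y = 0) ->
  {ae mu, forall x, b x = 0}.
Proof.
move=> ib b0.
have Vb : decay (zeroRd n) b.
  split => // y; have [c0 s0] := b0 y; split.
    by apply: cvg_near_cst; near=> k; have [] := b0 (addRd n y (scaleRd k%:R (zeroRd n))).
  by apply: cvg_near_cst; near=> k; have [] := b0 (addRd n y (scaleRd k%:R (zeroRd n))).
have H : ae_eq mu setT (EFin \o b) (cst 0%E).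
  apply: integral_ae_eq => // E _ mE.
  rewrite integral0.
  have [ibE /(_ (zeroRd n))[h _]] := exp_module_indic _ (exp_module_decay (zeroRd n)) _ _ mE Vb.
  have FE (k : nat) : FC (fun x => b x * \1_E x) (addRd n (zeroRd n) (scaleRd k%:R (zeroRd n)))
    = \int[mu]_x (b x * \1_E x).
    congr Rintegral; apply/funext => x.
    by rewrite dotRDr dotRZr !dotR0r mulr0 addr0 cos0 mulr1.
  have : \int[mu]_x (b x * \1_E x) = 0.
    move: h; under eq_fun do rewrite FE.
    by move=> /(cvg_lim (@norm_hausdorff _ _)); rewrite lim_cst//; exact: norm_hausdorff.
  rewrite /Rintegral => /eqP; rewrite fine_eq0; last exact: integrable_fin_num.
  move=> /eqP <-; rewrite integral_mkcond; apply: eq_integral => x _.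
  by rewrite patchE indicE /=; case: (_ \in _); rewrite ?mulr1 ?mulr0.
by apply: filterS H => x /(_ I)[].
Unshelve. all: by end_near. Qed.

(** Indicators act on [V], so it contains every simple function cut off to a cube. Monotone
    approximation with growing cubes reaches nonnegative integrable functions, and positive and
    negative parts give the rest. *)
Lemma exp_module_total (V : set (T -> R)) : exp_module V ->
  (forall k : nat, V (\1_(cube n (zeroRd n) k.+1%:R))) -> forall b, intg b -> V b.
Proof.
move=> emV Vc.
have V0 : V (fun=> 0).
  have := em_scale _ emV 0 _ (Vc 0%N).
  by congr V; apply/funext => x; rewrite mul0r.
have Vs (f : {nnsfun T >-> R}) k : V (fun x => \1_(cube n (zeroRd n) k.+1%:R) x * f x).
  pose s := fset_set (range f); pose N := size (finmap.enum_fset s).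
  pose t := fun i : nat => (finmap.enum_fset s)`_i.
  have H m : V (fun x => \1_(cube n (zeroRd n) k.+1%:R) x * \sum_(i < m) t i * \1_(f @^-1` [set t i]) x).
    elim: m => [|m IH].
      by have := V0; congr V; apply/funext => x; rewrite big_ord0 mulr0.
    have h : V (fun x => t m * (\1_(cube n (zeroRd n) k.+1%:R) x * \1_(f @^-1` [set t m]) x)).
      apply: em_scale => //; apply: exp_module_indic => //.
    have := em_add _ emV _ _ IH h; congr V; apply/funext => x.
    by rewrite big_ord_recr/= mulrDr; congr (_ + _); rewrite mulrCA.
  by have := H N; congr V; apply/funext => x; rewrite (fimfunEord f).
have Vp b : intg b -> (forall x, 0 <= b x) -> V b.
  move=> ib b0.
  have mb : measurable_fun setT (EFin \o b) by apply/measurable_EFinP; exact: intg_measurable.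
  pose f := nnsfun_approx measurableT mb.
  have fc x : (fun k => f k x) @ \oo --> b x.
    have b0' : forall x, setT x -> (0 <= (EFin \o b) x)%E by move=> u _; rewrite lee_fin.
    exact: (fine_cvg (cvg_nnsfun_approx measurableT mb b0' (x := x) I)).
  have fb k x : f k x <= b x.
    rewrite -(cvg_lim (@norm_hausdorff _ _) (fc x)).
    apply: (@nondecreasing_cvgn_le _ (fun k => f k x)); last by apply/cvg_ex; exists (b x).
    by move=> i j ij; exact: (lefP _ _ (nd_nnsfun_approx measurableT mb ij) x).
  apply: (em_dominated _ emV (fun k x => \1_(cube n (zeroRd n) k.+1%:R) x * f k x) _ b) => //.
  - move=> k x; rewrite normrM [`|f k x|]ger0_norm// indicE.
    by case: (_ \in _); rewrite ?normr1 ?normr0 ?mul1r ?mul0r.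
  - move=> x; rewrite -[b x]mul1r; apply: cvgM => //.
    have [K hK] := cube_exhaust n x.
    apply: cvg_near_cst; near=> k; rewrite indicE mem_set//; apply: hK.
    by apply: leqW; near: k; exact: nbhs_infty_ge.
move=> b ib.
have mb := intg_measurable _ ib.
have ip : intg (fun x => Num.max (b x) 0).
  apply: (intg_le _ b _ ib); first by apply: measurable_maxr => //; exact: measurable_cst.
  by move=> x; rewrite /Num.max; case: ifP => _; rewrite ?normr0.
have im : intg (fun x => Num.max (- b x) 0).
  apply: (intg_le _ b _ ib).
    by apply: measurable_maxr; [exact: measurable_funN | exact: measurable_cst].
  by move=> x; rewrite /Num.max; case: ifP => _; rewrite ?normr0 ?normrN.
have := em_add _ emV _ _ (Vp _ ip _) (em_scale _ emV (-1) _ (Vp _ im _)).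
have h (r : R) : 0 <= Num.max r 0 by rewrite le_max lexx orbT.
move=> /(_ (fun x => h _) (fun x => h _)); congr V; apply/funext => x.
by rewrite mulN1r /Num.max; case: ifPn => h1; case: ifPn => h2; lra.
Unshelve. all: by end_near. Qed.

End FourierTransform.

(** * The Riemann-Lebesgue lemma *)

Section RiemannLebesgue.
Context {R : realType}.

Lemma integral_cos_itv (al om r : R) : 0 < r -> om != 0 ->
  (\int[lebesgue_measure]_(t in `[(- r)%R, r%R]) (cos (al + om * t))%:E)%E
   = ((sin (al + om * r) - sin (al + om * - r)) / om)%:E.
Proof.
move=> r0 om0; have rr : - r < r by lra.
have dlin (t : R) : is_derive t (1 : R) (fun t => al + om * t) om.
  apply: (@is_derive_eq _ _ _ _ _ _ _ _ (is_deriveD (is_derive_cst al t 1) (is_deriveZ om (is_derive_id t 1)))).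
  by rewrite add0r scaleRE mulr1.
have clin : continuous (fun t : R => al + om * t).
  by move=> t; apply/differentiable_continuous/derivable1_diffP; case: (dlin t).
have ccos : continuous (fun t : R => cos (al + om * t)).
  move=> t; apply: (@continuous_comp _ _ _ (fun t : R => al + om * t) cos); first exact: clin.
  exact: continuous_cos.
pose F (t : R) := om^-1 * sin (al + om * t).
have dF (t : R) : is_derive t (1 : R) F (cos (al + om * t)).
  have d3 := @is_derive1_comp _ sin _ t _ _ (is_derive_sin (al + om * t)) (dlin t).
  apply: (@is_derive_eq _ _ _ _ _ _ _ _ (is_deriveZ om^-1 d3)).
  by rewrite scaleRE mulrCA mulVf// mulr1.
have cF : continuous F.
  by move=> t; apply/differentiable_continuous/derivable1_diffP; case: (dF t).
rewrite (@continuous_FTC2 _ _ F)//.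
- by rewrite -EFinB /F; congr EFin; rewrite mulrBl ![_ / om]mulrC.
- exact: continuous_subspaceT.
- split; first by move=> t _; case: (dF t).
    exact: cvg_at_right_filter (cF _).
  exact: cvg_at_left_filter (cF _).
- by move=> t _; rewrite derive1E; case: (dF t).
Qed.

(** Integrating the last coordinate first leaves a difference of two sines divided by [y.2]. The
    phase [ph = -pi/2] gives the same estimate for the sine. *)
Lemma cube_cos_bound n (y : Rd R n.+1) (ph r : R) : 0 < r -> y.2 != 0 ->
  `|\int[leb R n.+1]_x (\1_(cube n.+1 (zeroRd n.+1) r) x * cos (dotR x y + ph))|
  <= (2 * r) ^+ n * (2 / `|y.2|).
Proof.
move=> r0 y20.
pose C := cube n.+1 (zeroRd n.+1) r; pose c := cube n (zeroRd n) r.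
pose f (x : Rd R n.+1) : R := \1_C x * cos (dotR x y + ph).
have mC : measurable C by exact: measurable_cube.
have if_ : intg f.
  apply: intgM; last by move=> x; exact: cos_max.
    by apply: intg_indic => //; rewrite leb_cube ?ltry// ltW.
  apply: measurable_cosR; apply: measurable_funD; last exact: measurable_cst.
  exact: measurable_dotRl.
rewrite -lee_fin EFin_normr_Rintegral//.
(* [leb R n.+1] unfolds to a product measure; reading its first factor as [sleb n] supplies the
   sigma-finite structure that Fubini asks for. *)
have if2 : (sleb n \x lebesgue_measure)%E.-integrable setT (EFin \o f) by exact: if_.
have E := integral12_prod_meas1 if2.
have -> : (\int[leb R n.+1]_x (\1_C x * cos (dotR x y + ph))%:E)%E
  = (\int[sleb n]_x fubini_F lebesgue_measure (EFin \o f) x)%E by rewrite E.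
pose K (x : Rd R n) : R := (sin (dotR x y.1 + ph + y.2 * r) - sin (dotR x y.1 + ph + y.2 * - r)) / y.2.
have FE (x : Rd R n) : fubini_F lebesgue_measure (EFin \o f) x = (\1_c x * K x)%:E.
  rewrite /fubini_F EFinM -integral_cos_itv//.
  have fE t : f (x, t) = \1_c x * (\1_(`[-r, r]%classic) t * cos (dotR x y.1 + ph + y.2 * t)).
    rewrite /f mulrA; congr (_ * cos _); last by rewrite /=; ring.
    rewrite !indicE /C /=.
    have -> : ((x, t) \in c `*` `[0 - r, 0 + r]%classic) = (x \in c) && (t \in `[- r, r]%classic).
      by rewrite in_setX /= !add0r.
    by case: (x \in c); case: (t \in _); rewrite ?mulr1 ?mulr0.
  under eq_integral do rewrite /= fE.
  rewrite [in LHS]indicE indicE; case: (x \in c); last first.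
    by rewrite mul0e integral0_eq// => t _; rewrite mul0r.
  rewrite mul1e [RHS]integral_mkcond; apply: eq_integral => t _.
  by rewrite mul1r patchE indicE; case: (t \in _); rewrite ?mul1r ?mul0r.
apply: le_trans (le_abse_integral (sleb n) measurableT _) _.
  exact: measurable_int (integrable_fubini_F if2).
apply: (@le_trans _ _ (\int[sleb n]_x ((2 / `|y.2|)%:E * (\1_c x)%:E))%E).
  apply: ge0_le_integral => //.
  - apply: measurableT_comp => //; exact: measurable_int (integrable_fubini_F if2).
  - apply/measurable_EFinP; apply: measurable_funM => //.
    by apply: measurable_indic; exact: measurable_cube.
  move=> x _; rewrite FE -EFinM lee_fin normrM mulrC.
  apply: ler_pM => //; last by rewrite ger0_norm.
  rewrite /K normrM normfV ler_wpM2r ?invr_ge0//.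
  by apply: (le_trans (ler_normB _ _)); rewrite -[2]/(1 + 1) lerD ?sin_max.
rewrite ge0_integralZl//; last first.
  by apply/measurable_EFinP; apply: measurable_indic; exact: measurable_cube.
rewrite integral_indic//; last exact: measurable_cube.
rewrite setIT -[X in (_ * X <= _)%E]/(leb R n c) leb_cube ?(ltW r0)//.
by rewrite -EFinM lee_fin mulrC.
Qed.

Lemma decay_cube n (v : Rd R n.+1) (r : R) : 0 < r -> v.2 != 0 ->
  decay v (\1_(cube n.+1 (zeroRd n.+1) r)).
Proof.
move=> r0 v0; set C := cube _ _ _.
have iC : intg (\1_C : Rd R n.+1 -> R).
  apply: intg_indic; first exact: measurable_cube.
  by rewrite leb_cube ?ltry// ltW.
(* The last coordinate of the frequency [y + k v], the only one that enters the bound of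
   [cube_cos_bound]; it grows linearly because [v.2] is nonzero. *)
pose om (y : Rd R n.+1) (k : nat) := y.2 + k%:R * v.2.
have big y A : \forall k \near \oo, A <= `|om y k|.
  pose B := (`|A| + `|y.2|) / `|v.2|.
  have B0 : 0 <= B by rewrite divr_ge0// addr_ge0.
  near=> k.
  have Bk : B <= k%:R.
    apply: (le_trans (ltW (archi_boundP B0))); rewrite ler_nat.
    by near: k; exact: nbhs_infty_ge.
  move: Bk; rewrite /B ler_pdivrMr ?normr_gt0// => h.
  apply: (le_trans (ler_norm A)).
  have h2 : `|k%:R * v.2| <= `|om y k| + `|y.2|.
    have -> : k%:R * v.2 = om y k - y.2 by rewrite /om; ring.
    exact: ler_normB.
  by move: h2; rewrite normrM normr_nat; lra.
have lim y : (fun k => (2 * r) ^+ n * (2 / `|om y k|)) @ \oo --> (0 : R).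
  rewrite -(mulr0 ((2 * r) ^+ n)); apply: cvgMr.
  apply/cvgr0Pnorm_lt => e e0; have := big y (2 / e + 1); apply: filterS => k h.
  have e2 : 0 < 2 / e by rewrite divr_gt0.
  rewrite ger0_norm ?divr_ge0// ltr_pdivrMr; last by lra.
  by rewrite mulrC -ltr_pdivrMr//; lra.
have omn y : \forall k \near \oo, om y k != 0.
  by have := big y 1; apply: filterS => k h; rewrite -normr_gt0; lra.
have H ph y (u : nat -> R) : (forall k,
    u k = \int[leb R n.+1]_x (\1_C x * cos (dotR x (addRd n.+1 y (scaleRd k%:R v)) + ph))) ->
    u @ \oo --> (0 : R).
  move=> uE; apply/cvgr0Pnorm_lt => e e0.
  have /cvgr0Pnorm_lt/(_ _ e0) := lim y.
  apply: filterS2 (omn y) => k ok lk; rewrite uE.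
  apply: le_lt_trans lk; rewrite [leRHS]ger0_norm; first exact: cube_cos_bound.
  by rewrite mulr_ge0 ?exprn_ge0 ?divr_ge0// mulr_ge0// ltW.
split => // y; split.
  by apply: (H 0 y) => k; congr Rintegral; apply/funext => x; rewrite addr0.
by apply: (H (- (pi / 2)) y) => k; congr Rintegral; apply/funext => x; rewrite cosBpihalf.
Unshelve. all: by end_near. Qed.

(** The indicators of cubes decay by direct computation and generate all integrable functions by
    [exp_module_total]. Directions with [v.2 != 0] are enough later, because the vectors [normal s]
    for distinct angles in []0, pi[] differ in their last coordinate. *)
Lemma riemann_lebesgue n (v : Rd R n.+1) b : v.2 != 0 -> intg b -> decay v b.
Proof.
move=> v0; apply: exp_module_total; first exact: exp_module_decay.
by move=> k; exact: decay_cube.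
Qed.
End RiemannLebesgue.

(** * Analyticity of the Fourier transform along lines *)

Section FourierAnalytic.
Context {R : realType} {n : nat}.
Notation T := (Rd R n).
Notation mu := (leb R n).

(** The bound [cos_taylor_bound] is integrated against [b], with the [L1] norm of [b] as [C]. The
    phases [0] and [-pi/2] then yield the cosine and the sine transform. *)
Lemma taylor_entire_phase (b : T -> R) (r : R) (th v : T) (ph : R) :
  intg b -> (forall x, r < dotR x x -> b x = 0) ->
  taylor_entire (fun c => \int[mu]_x (b x * cos (dotR x th + ph + c * dotR x v))).
Proof.
move=> ib br.
(* This bounds [|dotR x v|] where [dotR x x <= r], by [dotR_bound]; the absolute value keeps [B]
   nonnegative when [r] is negative. *)
pose B := (`|r| + dotR v v) / 2.
have B0 : 0 <= B by rewrite divr_ge0// addr_ge0// dotR_ge0.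
have mb := intg_measurable _ ib.
have bB x : b x = 0 \/ `|dotR x v| <= B.
  have [h|h] := ltP r (dotR x x); [by left; exact: br | right].
  by have := dotR_bound n x v; rewrite /B; have := ler_norm r; lra.
pose t k x := cos (dotR x th + ph + k%:R * (pi / 2)) * (dotR x v ^+ k / k`!%:R).
have mphase al : measurable_fun setT (fun x : T => dotR x th + ph + al).
  apply: measurable_funD; last exact: measurable_cst.
  by apply: measurable_funD; [exact: measurable_dotRl | exact: measurable_cst].
have tB k x : `|b x * t k x| <= `|b x| * (B ^+ k / k`!%:R).
  have [->|h] := bB x; first by rewrite mul0r normr0 mul0r.
  rewrite normrM ler_wpM2l// /t normrM -[leRHS]mul1r; apply: ler_pM => //; first exact: cos_max.
  rewrite normrM normfV normr_nat ler_wpM2r ?invr_ge0// normrX.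
  by rewrite lerXn2r ?nnegrE.
have it k : intg (fun x => b x * t k x).
  apply: (intg_le _ _ _ (intgZ (B ^+ k / k`!%:R) _ ib)).
    apply: measurable_funM => //; apply: measurable_funM.
      by apply: measurable_cosR; exact: mphase.
    apply: measurable_funM; last exact: measurable_cst.
    by apply: measurable_funX; exact: measurable_dotRl.
  move=> x; apply: le_trans (tB k x) _.
  by rewrite [leRHS]normrM mulrC ler_wpM2r// ler_norm.
pose C := \int[mu]_x `|b x|.
have iab : intg (fun x => `|b x|) by exact: integrable_norm.
have intle (f : T -> R) K : 0 <= K -> intg f -> (forall x, `|f x| <= `|b x| * K) ->
    `|\int[mu]_x f x| <= C * K.
  move=> K0 if_ fK; apply: (le_trans (le_normr_Rintegral measurableT if_)).
  rewrite -RintegralZr//; apply: le_Rintegral => //; first exact: integrable_norm.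
  by have := intgZ K _ iab; congr intg; apply/funext => x; rewrite mulrC.
exists (fun k => \int[mu]_x (b x * t k x)), C, B; split => //.
- by apply: Rintegral_ge0.
- move=> k; apply: intle => //; first by rewrite divr_ge0// exprn_ge0.
move=> N c.
pose S M x := \sum_(k < M) cos (dotR x th + ph + k%:R * (pi / 2)) * ((c * dotR x v) ^+ k / k`!%:R).
have HS M : intg (fun x => b x * S M x) /\
    \int[mu]_x (b x * S M x) = \sum_(k < M) (\int[mu]_x (b x * t k x)) * c ^+ k.
  elim: M => [|M [i1 i2]].
    have E : (fun x => b x * S 0%N x) = (fun x => 0 * b x).
      by apply/funext => x; rewrite /S big_ord0 mulr0 mul0r.
    rewrite big_ord0 E; split; first exact: intgZ.
    by rewrite RintegralZl// mul0r.
  have E : (fun x => b x * S M.+1 x) = (fun x => b x * S M x + c ^+ M * (b x * t M x)).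
    apply/funext => x; rewrite /S big_ord_recr/= mulrDr; congr (_ + _).
    by rewrite exprMn /t; ring.
  rewrite E; split; first by apply: intgD => //; exact: intgZ.
  rewrite RintegralD//; last exact: intgZ.
  by rewrite i2 big_ord_recr/=; congr (_ + _); rewrite RintegralZl//; [rewrite mulrC | exact: it].
have [iS <-] := HS N.
have if_ : intg (fun x => b x * cos (dotR x th + ph + c * dotR x v)).
  apply: intgM => //; last by move=> x; exact: cos_max.
  apply: measurable_cosR; apply: measurable_funD; first by have := mphase 0; under eq_fun do rewrite addr0.
  by apply: measurable_funM; [exact: measurable_cst | exact: measurable_dotRl].
rewrite -RintegralB//; apply: intle.
- by rewrite divr_ge0// exprn_ge0// mulr_ge0.
- by have := integrableB measurableT if_ iS.
- move=> x; have [->|h] := bB x; first by rewrite !mul0r subrr normr0 mul0r.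
  rewrite -mulrBr normrM ler_wpM2l//; apply: le_trans (cos_taylor_bound _ _ _) _.
  rewrite ler_wpM2r ?invr_ge0// lerXn2r ?nnegrE ?mulr_ge0//.
    by rewrite addr_ge0// dotR_ge0.
  by rewrite normrM mulrC ler_wpM2r.
Qed.

Lemma taylor_entire_FC (b : T -> R) (r : R) (th v : T) :
  intg b -> (forall x, r < dotR x x -> b x = 0) ->
  taylor_entire (fun c => FC b (addRd n th (scaleRd c v))).
Proof.
move=> ib br; have := taylor_entire_phase b r th v 0 ib br.
congr taylor_entire; apply/funext => c; congr Rintegral; apply/funext => x.
by rewrite addr0 dotRDr dotRZr.
Qed.

Lemma taylor_entire_FS (b : T -> R) (r : R) (th v : T) :
  intg b -> (forall x, r < dotR x x -> b x = 0) ->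
  taylor_entire (fun c => FS b (addRd n th (scaleRd c v))).
Proof.
move=> ib br; have := taylor_entire_phase b r th v (- (pi / 2)) ib br.
congr taylor_entire; apply/funext => c; congr Rintegral; apply/funext => x.
by rewrite addrAC -dotRZr -dotRDr cosBpihalf.
Qed.

End FourierAnalytic.

(** * Plane waves as limits of Herglotz functions *)

Section Caps.
Context {R : realType}.

(** The vector [w] is [y - p], described through its pairings; its squared length is at most [n r^2]
    because each coordinate is at most [r] in absolute value. *)
Lemma cube_dist n (p y : Rd R n) (r : R) : 0 <= r -> cube n p r y ->
  exists2 w, dotR w w <= n%:R * r ^+ 2 & forall z, dotR z y = dotR z p + dotR z w.
Proof.
move=> r0; elim: n p y => [|n IH].
  by move=> p y _; exists (zeroRd 0) => [|z]; rewrite /= ?mul0r// addr0.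
move=> [p1 p2] [y1 y2] [/= /IH[w1 w1r w1E]]; rewrite in_itv/= => h.
exists ((w1, y2 - p2) : (Rd R n * R)%type) => /=.
  rewrite -natr1 [leRHS]mulrDl mul1r lerD// -expr2.
  have : `|y2 - p2| <= r by rewrite ler_norml; lra.
  by move=> h2; rewrite -[leLHS]real_normK ?num_real// lerXn2r ?nnegrE.
by move=> [z1 z2] /=; rewrite w1E; ring.
Qed.

(** Apply [dotR_bound] to [sqrt s x] and [y / sqrt s]. The weight makes the bound small when [y] has
    length of order [s] and [x] is fixed. *)
Lemma dotR_bound_scaled n (x y : Rd R n) (s : R) : 0 < s ->
  2 * `|dotR x y| <= s * dotR x x + dotR y y / s.
Proof.
move=> s0; pose t := Num.sqrt s.
have t0 : 0 < t by rewrite sqrtr_gt0.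
have ts : t * t = s by rewrite -expr2 sqr_sqrtr// ltW.
have := dotR_bound n (scaleRd t x) (scaleRd t^-1 y).
rewrite !dotRZl !dotRZr !mulrA ts -invfM ts mulfV ?gt_eqF// mul1r.
by rewrite (mulrC s^-1).
Qed.

Lemma dotR_normalize n (z y : Rd R n) : dotR z (normalize y) = dotR z y / Num.sqrt (dotR y y).
Proof. by rewrite /normalize dotRZr mulrC. Qed.

Lemma normalize_sphere n (y : Rd R n) : 0 < dotR y y -> dotR (normalize y) (normalize y) = 1.
Proof.
move=> y0; rewrite dotR_normalize dotRC dotR_normalize -mulrA -invfM -expr2.
by rewrite sqr_sqrtr ?ltW// mulfV// gt_eqF.
Qed.

Definition cap n (xi : Rd R n) (e : R) : set (Rd R n) := [set y | 1 - e < dotR xi y].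

(** By the cone formula, [n] times the volume of this set is the surface measure of the cap. *)
Definition cone n (xi : Rd R n) (e : R) : set (Rd R n) :=
  @punctured_ball R n `&` [set y | cap n xi e (normalize y)].

Lemma measurable_punctured_ball n : measurable (@punctured_ball R n).
Proof.
have m : measurable_fun setT (fun x : Rd R n => dotR x x).
  by apply: measurable_dotR; exact: measurable_id.
have := m measurableT `]0, 1]%classic (measurable_itv _); rewrite setTI.
by congr measurable; apply/seteqP; split => x /=; rewrite in_itv.
Qed.

Lemma measurable_cap n (xi : Rd R n) e : measurable (cap n xi e).
Proof.
have m : measurable_fun setT (fun x : Rd R n => dotR xi x).
  by apply: measurable_dotR; [exact: measurable_cst | exact: measurable_id].
have := m measurableT `]1 - e, +oo[%classic (measurable_itv _); rewrite setTI.
by congr measurable; apply/seteqP; split => x /=; rewrite in_itv/= andbT.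
Qed.

Lemma measurable_cone n (xi : Rd R n) e : measurable (cone n xi e).
Proof.
apply: measurableI; first exact: measurable_punctured_ball.
have := measurable_normalize n measurableT _ (measurable_cap n xi e).
by rewrite setTI.
Qed.

Lemma leb_punctured_ball n : (leb R n (@punctured_ball R n) < +oo)%E.
Proof.
apply: (@le_lt_trans _ _ (leb R n (cube n (zeroRd n) 1))).
  apply: le_measure; rewrite ?inE; [exact: measurable_punctured_ball|exact: measurable_cube|].
  by move=> x /andP[_ h]; apply: cube_cover => //; rewrite expr1n.
by rewrite leb_cube// ltry.
Qed.

Lemma leb_cone_lty n (xi : Rd R n) e : (leb R n (cone n xi e) < +oo)%E.
Proof.
apply: le_lt_trans (leb_punctured_ball n).
apply: le_measure; rewrite ?inE; [exact: measurable_cone|exact: measurable_punctured_ball|].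
by move=> x [].
Qed.

(** The cone contains a small cube around [xi / 2], a centre that is away from both the origin and
    the sphere. *)
Lemma leb_cone_gt0 n (xi : Rd R n) e : dotR xi xi = 1 -> 0 < e -> e <= 1 ->
  (0 < leb R n (cone n xi e))%E.
Proof.
move=> xi1 e0 e1.
(* The side is chosen so that [n r^2 <= eta^2]: points of the cube are within [eta] of [xi / 2], and
   the factor 16 leaves room for the quadratic comparison that ends the proof. *)
pose eta := e / 16; have eta0 : 0 < eta by rewrite divr_gt0.
pose r := eta / n.+1%:R; have r0 : 0 < r by rewrite divr_gt0.
apply: (@lt_le_trans _ _ (leb R n (cube n (scaleRd 2^-1 xi) r))).
  by rewrite leb_cube ?(ltW r0)// lte_fin exprn_gt0// mulr_gt0.
apply: le_measure; rewrite ?inE; [exact: measurable_cube|exact: measurable_cone|].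
move=> y /(cube_dist _ _ _ _ (ltW r0))[w wr wE].
have {}wr : dotR w w <= eta ^+ 2.
  apply: (le_trans wr); rewrite /r expr_div_n mulrCA ler_piMr ?sqr_ge0//.
  by rewrite ler_pdivrMr ?exprn_gt0// mul1r -natrX ler_nat (leq_trans (leqnSn n))// expnS leq_pmulr.
have wxi : `|dotR xi w| <= eta.
  have := dotR_bound_scaled n xi w eta eta0; rewrite xi1 mulr1.
  have : dotR w w / eta <= eta by rewrite ler_pdivrMr// -expr2.
  lra.
have w0 := dotR_ge0 n w.
have xiy : dotR xi y = 1 / 2 + dotR xi w by rewrite wE dotRZr xi1; lra.
have yy : dotR y y = 1 / 4 + dotR xi w + dotR w w.
  rewrite wE dotRZr (dotRC _ y xi) xiy (dotRC _ y w) wE dotRZr (dotRC _ w xi); lra.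
have eta16 : eta * 16 = e by rewrite /eta; field.
have eta2 : eta ^+ 2 <= eta by rewrite expr2 ler_piMr ?ltW//; lra.
move: wxi; rewrite ler_norml => /andP[wx1 wx2].
have y0 : 0 < dotR y y by rewrite yy; lra.
split; first by rewrite /punctured_ball/= y0 yy; lra.
rewrite /cap /= dotR_normalize ltr_pdivlMr ?sqrtr_gt0//.
have q : Num.sqrt (dotR y y) ^+ 2 = dotR y y by rewrite sqr_sqrtr// ltW.
rewrite -ltr_sqr ?nnegrE ?mulr_ge0 ?sqrtr_ge0 ?subr_ge0//; last by rewrite xiy; lra.
rewrite exprMn q xiy yy; nra.
Qed.

Section Average.
Variables (n : nat) (xi : Rd R n) (e : R).
Hypotheses (xi1 : dotR xi xi = 1) (e0 : 0 < e) (e1 : e <= 1).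

Let E := cone n xi e.
Let M : R := fine (leb R n E).

Let M0 : 0 < M.
Proof.
have := leb_cone_gt0 n xi e xi1 e0 e1; have := leb_cone_lty n xi e.
by rewrite /M /E => h1 h2; rewrite fine_gt0// h2.
Qed.

Let iE : intg (\1_E : Rd R n -> R).
Proof. by apply: intg_indic; [exact: measurable_cone | exact: leb_cone_lty]. Qed.

Let ME : \int[leb R n]_y (\1_E y) = M.
Proof. by rewrite /Rintegral integral_indic ?setIT//; exact: measurable_cone. Qed.

Definition cap_average (ph : R) (x : Rd R n) : R :=
  M^-1 * \int[leb R n]_y (\1_E y * cos (dotR x (normalize y) + ph)).

Let icos ph x : intg (fun y => \1_E y * cos (dotR x (normalize y) + ph)).
Proof.
apply: intgM => //; last by move=> y; exact: cos_max.
apply: measurable_cosR; apply: measurable_funD; last exact: measurable_cst.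
by apply: measurable_dotR; [exact: measurable_cst | exact: measurable_normalize].
Qed.

Lemma cap_average_dist ph x K (t : R) :
  (forall y, E y -> `|cos (dotR x (normalize y) + ph) - t| <= K) ->
  `|cap_average ph x - t| <= K.
Proof.
move=> h.
have -> : cap_average ph x - t =
    M^-1 * \int[leb R n]_y (\1_E y * cos (dotR x (normalize y) + ph) - t * \1_E y).
  rewrite RintegralB//; [|exact: icos|exact: intgZ].
  by rewrite RintegralZl// ME mulrBr mulrCA mulVf ?gt_eqF// mulr1.
rewrite normrM normfV (gtr0_norm M0) ler_pdivrMl// -ME.
have iB : intg (fun y => \1_E y * cos (dotR x (normalize y) + ph) - t * \1_E y).
  by have := integrableB measurableT (icos ph x) (intgZ t _ iE).
apply: (le_trans (le_normr_Rintegral measurableT iB)).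
rewrite -RintegralZr//; apply: le_Rintegral => //.
- exact: integrable_norm.
- by have := intgZ K _ iE; congr intg; apply/funext => y; rewrite mulrC.
move=> y _; rewrite indicE; have [yE|yE] := boolP (y \in E).
  by rewrite mul1r mulr1 mul1r; apply: h; exact: set_mem.
by rewrite mul0r mulr0 subr0 normr0 mul0r.
Qed.

Lemma cap_average_le1 ph x : `|cap_average ph x| <= 1.
Proof.
by rewrite -[cap_average _ _]subr0; apply: cap_average_dist => y _; rewrite subr0 cos_max.
Qed.

Lemma measurable_cap_average ph : measurable_fun setT (cap_average ph).
Proof.
(* Adding 1 makes the integrand nonnegative, so measurability in [x] comes from Tonelli; the added
   constant integrates to [M] and is subtracted again. *)
pose f (z : Rd R n * Rd R n) : \bar R := (\1_E z.2 * (1 + cos (dotR z.1 (normalize z.2) + ph)))%:E.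
have mf : measurable_fun setT f.
  apply/measurable_EFinP; apply: measurable_funM.
    apply: (@measurableT_comp _ _ _ _ _ _ (\1_E : Rd R n -> R)) => //.
    by apply: measurable_indic; exact: measurable_cone.
  apply: measurable_funD; first exact: measurable_cst.
  apply: measurable_cosR; apply: measurable_funD; last exact: measurable_cst.
  apply: measurable_dotR; first exact: measurable_fst.
  by apply: measurableT_comp; [exact: measurable_normalize | exact: measurable_snd].
have f0 z : (0 <= f z)%E.
  by rewrite lee_fin mulr_ge0//; have := cos_geN1 (dotR z.1 (normalize z.2) + ph); lra.
have mF := @measurable_fun_fubini_tonelli_F _ _ _ _ R (sleb n) f mf f0.
have FE x : fine (fubini_F (sleb n) f x) = M + M * cap_average ph x.
  rewrite /cap_average mulrA mulfV ?gt_eqF// mul1r -ME -RintegralD//; [|exact: icos].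
  by congr Rintegral; apply/funext => y; rewrite mulrDr mulr1.
apply: (eq_measurable_fun (fun x => M^-1 * fine (fubini_F (sleb n) f x) - 1)).
  move=> x _.
  by rewrite FE mulrDr mulVf ?gt_eqF// mulrA mulVf ?gt_eqF// mul1r addrC addKr.
apply: measurable_funB; last exact: measurable_cst.
apply: measurable_funM; first exact: measurable_cst.
by apply: measurableT_comp mF; exact: fine_measurable.
Qed.

End Average.
End Caps.

Section HerglotzDelta.
Context {R : realType}.
Local Notation C := (R[i]).

Lemma cos_lipschitz (a y : R) : `|cos (a + y) - cos a| <= `|y|.
Proof.
have := cos_taylor_bound a y 1.
by rewrite big_ord1 mul0r addr0 expr0 fact0 divr1 mulr1 expr1 divr1.
Qed.

(** A cap of height [dl^2] has radius of order [dl]: its points satisfy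
    [|y - xi|^2 = 2 - 2 <xi, y> <= 2 dl^2]. The cosine is 1-Lipschitz, and [dotR_bound_scaled] with
    weight [dl] gives the stated constant. *)
Lemma cap_average_cvg n (xi : Rd R n) (dl ph : R) x : dotR xi xi = 1 ->
  0 < dl -> dl <= 1 ->
  `|cap_average n xi (dl ^+ 2) ph x - cos (dotR x xi + ph)| <= dl * ((dotR x x + 2) / 2).
Proof.
move=> xi1 d0 d1; apply: cap_average_dist => //.
- by rewrite exprn_gt0.
- by rewrite exprn_ile1// ltW.
move=> y [/andP[y0 _]]; rewrite /cap /= => ycap.
set ny := normalize y in ycap *.
pose w := addRd n ny (oppRd xi).
have wE : dotR x w = dotR x ny - dotR x xi by rewrite dotRDr dotRNr.
have ww : dotR w w <= 2 * dl ^+ 2.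
  have nn : dotR ny ny = 1 by exact: normalize_sphere.
  by rewrite /w dotRDr dotRNr !dotRDl nn (dotRC _ ny xi) ![dotR (oppRd _) _]dotRZl xi1; lra.
have := dotR_bound_scaled n x w dl d0.
have : dotR w w / dl <= 2 * dl by rewrite ler_pdivrMr// -mulrA -expr2.
have := cos_lipschitz (dotR x xi + ph) (dotR x w).
have -> : dotR x xi + ph + dotR x w = dotR x ny + ph by rewrite wE; lra.
by move=> h1 h2 h3; lra.
Qed.

Lemma scale_Complex (k a b : R) : (k%:C)%C * Complex a b = Complex (k * a) (k * b).
Proof. by rewrite -[LHS]/(Complex _ _); congr Complex; rewrite mul0r ?subr0 ?addr0. Qed.

Lemma c_const_gt0 n : 0 < c_const R n.
Proof.
by rewrite divr_gt0// ?sqrtr_gt0 ?pi_gt0// powR_gt0// mulr_gt0// pi_gt0.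
Qed.

(** The factor cancels the Herglotz constant, the [n] of the cone formula and the volume of the
    cone, so that the Herglotz function becomes a mean of plane waves over the cap. *)
Definition cap_fun n (xi : Rd R n) (e : R) : Rd R n -> C := fun y =>
  (((c_const R n * n%:R * fine (leb R n (cone n xi e)))^-1 * \1_(cap n xi e) y)%:C)%C.

Lemma herglotz_cap_fun n (xi : Rd R n) e x : (0 < n)%N ->
  herglotz (cap_fun n xi e) x =
  Complex (cap_average n xi e 0 x) (cap_average n xi e (- (pi / 2)) x).
Proof.
move=> n0; set K := (c_const R n * n%:R * fine (leb R n (cone n xi e)))^-1.
have I ph (f : Rd R n -> R) : (forall y, f (normalize y) = K * \1_(cap n xi e) (normalize y) * cos (dotR x (normalize y) + ph)) ->
    c_const R n * (n%:R * \int[leb R n]_(y in @punctured_ball R n) f (normalize y)) = cap_average n xi e ph x.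
  move=> fE; under eq_Rintegral do rewrite fE.
  rewrite Rintegral_mkcond (_ : _ \_ _ = (fun y => K * (\1_(cone n xi e) y * cos (dotR x (normalize y) + ph)))); last first.
    apply/funext => y; rewrite patchE /cone indicI /= mulrA [in LHS]indicE [in RHS]indicE.
    rewrite [X in _ = K * (_ * X) * _]indicE.
    have -> : (y \in [set z | cap n xi e (normalize z)]) = (normalize y \in cap n xi e).
      by apply/idP/idP => /set_mem h; exact: mem_set.
    by case: (y \in _); rewrite ?mul1r// !mul0r mulr0 mul0r.
  rewrite RintegralZl//; last first.
    apply: intgM; first by apply: intg_indic; [exact: measurable_cone | exact: leb_cone_lty].
      apply: measurable_cosR; apply: measurable_funD; last exact: measurable_cst.
      by apply: measurable_dotR; [exact: measurable_cst | exact: measurable_normalize].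
    by move=> y; exact: cos_max.
  rewrite /cap_average !mulrA; congr (_ * _).
  rewrite /K invfM; have c0 := c_const_gt0 n.
  by rewrite mulrA mulfV ?mul1r// mulf_neq0 ?gt_eqF// ?ltr0n.
rewrite /herglotz /Sint /Cint [X in _ * X]scale_Complex scale_Complex; congr Complex.
- apply: (I _ (fun xi0 => complex.Re (cap_fun n xi e xi0 * cexpi (dotR x xi0)))) => y.
  by rewrite /cap_fun scale_Complex /= addr0.
- apply: (I _ (fun xi0 => complex.Im (cap_fun n xi e xi0 * cexpi (dotR x xi0)))) => y.
  by rewrite /cap_fun scale_Complex /= cosBpihalf.
Qed.

Lemma L2S_cap_fun n (xi : Rd R n) e : L2S (cap_fun n xi e).
Proof.
split.
  split; apply: measurable_funTS => //=.
  apply: measurable_funM; first exact: measurable_cst.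
    by apply: measurable_indic; exact: measurable_cap.
set K := (c_const R n * n%:R * fine (leb R n (cone n xi e)))^-1.
have H y : cabs (cap_fun n xi e y) ^+ 2 = (K * \1_(cap n xi e) y) ^+ 2.
  by rewrite /cabs /= expr0n addr0 sqr_sqrtr// sqr_ge0.
apply: (@le_lt_trans _ _ (\int[leb R n]_(x in @punctured_ball R n) (K ^+ 2)%:E)%E).
  apply: ge0_le_integral => //.
  - exact: measurable_punctured_ball.
  - by move=> x _; rewrite lee_fin sqr_ge0.
  - apply: measurable_funTS; apply/measurable_EFinP; under eq_fun do rewrite H.
    apply: measurable_funX; apply: measurable_funM; first exact: measurable_cst.
    apply: (@measurableT_comp _ _ _ _ _ _ (\1_(cap n xi e) : Rd R n -> R)); last exact: measurable_normalize.
    by apply: measurable_indic; exact: measurable_cap.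
  - move=> x _; rewrite lee_fin H exprMn ler_piMr ?sqr_ge0// indicE; case: (_ \in _); rewrite ?expr1n ?expr0n.
rewrite integral_cst; last exact: measurable_punctured_ball.
by rewrite lte_mul_pinfty ?lee_fin ?sqr_ge0//; exact: leb_punctured_ball.
Qed.

(** Caps of height [(k + 1)^-2] approximate a point mass at [xi]. Convergence is only pointwise in
    [x]; together with the uniform bound 1 and measurability it is what dominated convergence
    against an [L1] symbol requires. *)
Lemma herglotz_delta n (xi : Rd R n) : (0 < n)%N -> dotR xi xi = 1 ->
  exists ph : nat -> Rd R n -> C,
    [/\ forall k, L2S (ph k),
        forall k, Cmeasurable setT (herglotz (ph k)),
        forall k x, `|complex.Re (herglotz (ph k) x)| <= 1 /\ `|complex.Im (herglotz (ph k) x)| <= 1 &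
        forall x, (fun k => complex.Re (herglotz (ph k) x)) @ \oo --> cos (dotR x xi) /\
                  (fun k => complex.Im (herglotz (ph k) x)) @ \oo --> sin (dotR x xi)].
Proof.
move=> n0 xi1; pose dl k : R := k.+1%:R^-1.
have d0 k : 0 < dl k by rewrite invr_gt0.
have d1 k : dl k <= 1 by rewrite invf_le1 ?ltr0n// ler1n.
have e0 k : 0 < dl k ^+ 2 by rewrite exprn_gt0.
have e1 k : dl k ^+ 2 <= 1 by rewrite exprn_ile1// ltW.
have cv x p : (fun k => cap_average n xi (dl k ^+ 2) p x) @ \oo --> cos (dotR x xi + p).
  apply/subr_cvg0; apply/cvgr0Pnorm_lt => e epos.
  pose A := (dotR x x + 2) / 2.
  have A0 : 0 < A by have := dotR_ge0 n x; rewrite /A; lra.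
  have /cvgr0Pnorm_lt/(_ (e / A)) := @cvg_harmonic R.
  move=> /(_ (divr_gt0 epos A0)); apply: filterS => k hk.
  apply: le_lt_trans (cap_average_cvg _ _ _ _ _ xi1 (d0 k) (d1 k)) _.
  move: hk; rewrite /harmonic ger0_norm ?invr_ge0// => hk.
  by rewrite -/A -ltr_pdivlMr.
exists (fun k => cap_fun n xi (dl k ^+ 2)); split.
- by move=> k; exact: L2S_cap_fun.
- move=> k; split; under eq_fun do rewrite herglotz_cap_fun//.
    exact: measurable_cap_average.
  exact: measurable_cap_average.
- by move=> k x; rewrite herglotz_cap_fun//=; split; exact: cap_average_le1.
move=> x; split; under eq_fun do rewrite herglotz_cap_fun//=.
  by have := cv x 0; rewrite addr0.
by have := cv x (- (pi / 2)); rewrite cosBpihalf.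
Qed.
End HerglotzDelta.

(** * The determinant identity *)

Section ComplexClosure.
Context {R : realType} {X : Type}.
Local Notation C := (R[i]).
Variable P : (X -> R) -> Prop.
Hypothesis Pcst : forall k, P (fun=> k).
Hypothesis PD : forall f g, P f -> P g -> P (fun x => f x + g x).
Hypothesis PM : forall f g, P f -> P g -> P (fun x => f x * g x).

Definition componentwise (f : X -> C) :=
  P (fun x => complex.Re (f x)) /\ P (fun x => complex.Im (f x)).

Lemma complex_ReM (z w : C) :
  complex.Re (z * w) = complex.Re z * complex.Re w - complex.Im z * complex.Im w.
Proof. by case: z w => [a b] [c d]. Qed.

Lemma complex_ImM (z w : C) :
  complex.Im (z * w) = complex.Re z * complex.Im w + complex.Im z * complex.Re w.
Proof. by case: z w => [a b] [c d]. Qed.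

Lemma complex_ReD (z w : C) : complex.Re (z + w) = complex.Re z + complex.Re w.
Proof. by case: z w => [a b] [c d]. Qed.

Lemma complex_ImD (z w : C) : complex.Im (z + w) = complex.Im z + complex.Im w.
Proof. by case: z w => [a b] [c d]. Qed.

Let PB f g : P f -> P g -> P (fun x => f x - g x).
Proof.
move=> hf hg; have := PD _ _ hf (PM _ _ (Pcst (-1)) hg).
by congr P; apply/funext => x; rewrite mulN1r.
Qed.

Let cD f g : componentwise f -> componentwise g -> componentwise (fun x => f x + g x).
Proof.
move=> [f1 f2] [g1 g2]; split.
  by under eq_fun do rewrite complex_ReD; exact: PD.
by under eq_fun do rewrite complex_ImD; exact: PD.
Qed.

Let cM f g : componentwise f -> componentwise g -> componentwise (fun x => f x * g x).
Proof.
move=> [f1 f2] [g1 g2]; split.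
  by under eq_fun do rewrite complex_ReM; apply: PB; exact: PM.
by under eq_fun do rewrite complex_ImM; apply: PD; exact: PM.
Qed.

Let ccst k : componentwise (fun=> k).
Proof. by split; exact: Pcst. Qed.

(** A determinant is a polynomial in the real and imaginary parts of the entries, so any class of
    real functions with constants, sums and products will do. It is used with [taylor_entire] and
    with convergent sequences. *)
Lemma componentwise_det N (M : X -> 'M[C]_N) :
  (forall i j, componentwise (fun x => M x i j)) -> componentwise (fun x => \det (M x)).
Proof.
move=> hM; rewrite /determinant.
have csum I (s : seq I) (F : I -> X -> C) : (forall i, componentwise (F i)) ->
    componentwise (fun x => \sum_(i <- s) F i x).
  move=> hF; elim: s => [|i s IH]; first by under eq_fun do rewrite big_nil; exact: ccst.
  by under eq_fun do rewrite big_cons; exact: cD.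
have cprod I (s : seq I) (F : I -> X -> C) : (forall i, componentwise (F i)) ->
    componentwise (fun x => \prod_(i <- s) F i x).
  move=> hF; elim: s => [|i s IH]; first by under eq_fun do rewrite big_nil; exact: ccst.
  by under eq_fun do rewrite big_cons; exact: cM.
apply: csum => s; apply: cM; first exact: ccst.
exact: cprod.
Qed.
End ComplexClosure.

Section SequencesWithLimit.
Context {R : realType}.
Local Notation C := (R[i]).

Definition cvgC (u : nat -> C) (l : C) :=
  (fun k => complex.Re (u k)) @ \oo --> complex.Re l /\
  (fun k => complex.Im (u k)) @ \oo --> complex.Im l.

(* Sequences with a limit form a ring of functions on [option nat], the value
   at [None] being the limit. *)
Lemma cvgC_det N (M : nat -> 'M[C]_N) (L : 'M[C]_N) :
  (forall i j, cvgC (fun k => M k i j) (L i j)) -> cvgC (fun k => \det (M k)) (\det L).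
Proof.
move=> hM.
pose P (f : option nat -> R) := (fun k => f (Some k)) @ \oo --> f None.
have := @componentwise_det R (option nat) P _ _ _ N (fun x => if x is Some k then M k else L).
apply.
- by move=> k; exact: cvg_cst.
- by move=> f g; exact: cvgD.
- by move=> f g; exact: cvgM.
- exact: hM.
Qed.

Lemma cvgC0_eq0 (u : nat -> C) l : (forall k, u k = 0) -> cvgC u l -> l = 0.
Proof.
have H (v : nat -> R) t : (forall k, v k = 0) -> v @ \oo --> t -> t = 0.
  move=> v0 vt; rewrite -(cvg_lim (@norm_hausdorff _ _) vt).
  apply: cvg_lim; first exact: norm_hausdorff.
  by apply: cvg_near_cst; apply: nearW.
move=> u0 [h1 h2]; case: l h1 h2 => a b /= h1 h2.
by rewrite (H _ _ _ h1) ?(H _ _ _ h2)// => k; rewrite u0.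
Qed.

Lemma det_low_rank N k (A : 'M[C]_(N, k)) (B : 'M[C]_(k, N)) :
  (k < N)%N -> \det (A *m B) = 0.
Proof.
move=> kN; apply/eqP; apply/negPn/negP => d0.
have : (A *m B) \in unitmx by rewrite unitmxE unitfE.
move=> /mxrank_unit rN; have := leq_trans (mxrankM_maxl A B) (rank_leq_col A).
by rewrite rN leqNgt kN.
Qed.
End SequencesWithLimit.

Section Kernel.
Context {R : realType} {n : nat}.
Local Notation C := (R[i]).
Notation T := (Rd R n).
Implicit Types (p q : T -> R).

(** The unnormalised transform of [p + i q] against [e^{i <x, y>}], the function called A in the
    overview. *)
Definition fourier p q (y : T) : C := Complex (FC p y - FS q y) (FS p y + FC q y).

Lemma fourier_ext p q y z : (forall x, dotR x y = dotR x z) -> fourier p q y = fourier p q z.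
Proof. by move=> h; rewrite /fourier !(FC_ext _ _ _ h) !(FS_ext _ _ _ h). Qed.

Lemma intg_L1 (a : T -> C) : L1 a ->
  intg (fun x => complex.Re (a x)) /\ intg (fun x => complex.Im (a x)).
Proof.
move=> [[m1 m2] aoo].
have mc : measurable_fun setT (fun x => cabs (a x)).
  rewrite (_ : (fun _ => _) = (@powR R)^~ 2^-1 \o (fun x => complex.Re (a x) ^+ 2 + complex.Im (a x) ^+ 2)).
    apply: measurableT_comp; first exact: measurable_powR.
    by apply: measurable_funD; exact: measurable_funX.
  by apply/funext => x /=; rewrite powR12_sqrt// addr_ge0// sqr_ge0.
have ic : intg (fun x => cabs (a x)).
  apply/integrableP; split; first exact/measurable_EFinP.
  by under eq_integral do rewrite /= ger0_norm ?sqrtr_ge0//.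
have H (u v : R) : `|u| <= Num.sqrt (u ^+ 2 + v ^+ 2).
  by rewrite -sqrtr_sqr ler_wsqrtr// lerDl sqr_ge0.
have cx x : `|cabs (a x)| = cabs (a x) by rewrite ger0_norm// sqrtr_ge0.
split; apply: (intg_le _ _ _ ic) => // x; rewrite cx; first exact: H.
by rewrite /cabs addrC; exact: H.
Qed.

Lemma cvgC_Fa (a : T -> C) (u v : nat -> T -> C) (xi eta : T) : L1 a ->
  (forall k, Cmeasurable setT (u k)) -> (forall k, Cmeasurable setT (v k)) ->
  (forall k x, `|complex.Re (u k x)| <= 1 /\ `|complex.Im (u k x)| <= 1) ->
  (forall k x, `|complex.Re (v k x)| <= 1 /\ `|complex.Im (v k x)| <= 1) ->
  (forall x, cvgC (u ^~ x) (cexpi (dotR x xi))) ->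
  (forall x, cvgC (v ^~ x) (cexpi (dotR x eta))) ->
  cvgC (fun k => Fa a (u k) (v k))
    (fourier (fun x => complex.Re (a x)) (fun x => complex.Im (a x)) (addRd n xi (oppRd eta))).
Proof.
move=> La mu_ mv_ u1 v1 uc vc.
set p := fun x => complex.Re (a x); set q := fun x => complex.Im (a x).
have [ip iq] : intg p /\ intg q by exact: intg_L1.
have mp := intg_measurable _ ip; have mq := intg_measurable _ iq.
pose g x := 2 * (`|p x| + `|q x|).
have ig : intg g.
  by apply: intgZ; apply: intgD; exact: integrable_norm.
(* [w1 + i w2] is [u] times the conjugate of [v]; its limit is the plane wave of frequency
   [xi - eta]. *)
pose w1 k x := complex.Re (u k x) * complex.Re (v k x) + complex.Im (u k x) * complex.Im (v k x).
pose w2 k x := complex.Im (u k x) * complex.Re (v k x) - complex.Re (u k x) * complex.Im (v k x).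
have w1B k x : `|w1 k x| <= 2.
  have [h1 h2] := u1 k x; have [h3 h4] := v1 k x.
  apply: (le_trans (ler_normD _ _)); rewrite !normrM -[2]/(1 + 1).
  by apply: lerD; rewrite mulr_ile1.
have w2B k x : `|w2 k x| <= 2.
  have [h1 h2] := u1 k x; have [h3 h4] := v1 k x.
  apply: (le_trans (ler_normB _ _)); rewrite !normrM -[2]/(1 + 1).
  by apply: lerD; rewrite mulr_ile1.
have mw1 k : measurable_fun setT (w1 k).
  by have [? ?] := mu_ k; have [? ?] := mv_ k; apply: measurable_funD; exact: measurable_funM.
have mw2 k : measurable_fun setT (w2 k).
  by have [? ?] := mu_ k; have [? ?] := mv_ k; apply: measurable_funB; exact: measurable_funM.
have cw1 x : w1 ^~ x @ \oo --> cos (dotR x (addRd n xi (oppRd eta))).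
  have [h1 h2] := uc x; have [h3 h4] := vc x.
  rewrite dotRDr dotRNr cosD cosN sinN mulrN opprK.
  by apply: cvgD; exact: cvgM.
have cw2 x : w2 ^~ x @ \oo --> sin (dotR x (addRd n xi (oppRd eta))).
  have [h1 h2] := uc x; have [h3 h4] := vc x.
  rewrite dotRDr dotRNr sinD cosN sinN mulrN.
  by apply: cvgB; exact: cvgM.
have gB (s t : R) x (b1 b2 : R) : `|s| <= 2 -> `|t| <= 2 -> `|b1| = `|p x| -> `|b2| = `|q x| ->
    `|b1 * s + b2 * t| <= g x.
  move=> h1 h2 e1 e2; apply: (le_trans (ler_normD _ _)).
  rewrite /g mulrDr !normrM e1 e2; apply: lerD; rewrite mulrC; exact: ler_wpM2r.
set y := addRd n xi (oppRd eta).
have lim (b1 b2 : T -> R) (s_ t_ : nat -> T -> R) (s t : T -> R) : intg b1 -> intg b2 ->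
    (forall x, `|b1 x| = `|p x|) -> (forall x, `|b2 x| = `|q x|) ->
    (forall k, measurable_fun setT (s_ k)) -> (forall k, measurable_fun setT (t_ k)) ->
    (forall k x, `|s_ k x| <= 2) -> (forall k x, `|t_ k x| <= 2) ->
    (forall x, s_ ^~ x @ \oo --> s x) -> (forall x, t_ ^~ x @ \oo --> t x) ->
    (fun k => \int[leb R n]_x (b1 x * s_ k x + b2 x * t_ k x)) @ \oo -->
    \int[leb R n]_x (b1 x * s x + b2 x * t x).
  move=> i1 i2 e1 e2 ms mt sB tB sc tc.
  have [||| _ _ //] := Rintegral_dominated _ _ _ (leb R n)
    (fun k x => b1 x * s_ k x + b2 x * t_ k x) (fun x => b1 x * s x + b2 x * t x) g _ ig.
  - by move=> k; apply: measurable_funD; apply: measurable_funM => //; exact: intg_measurable.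
  - by move=> k x; exact: gB.
  - by move=> x; apply: cvgD; apply: cvgMr.
have inq : intg (fun x => - q x).
  by have := intgZ (-1) _ iq; congr intg; apply/funext => x; rewrite mulN1r.
split.
- have := lim p (fun x => - q x) w1 w2 _ _ ip inq (fun=> erefl) (fun x => normrN _) mw1 mw2 w1B w2B cw1 cw2.
  rewrite /fourier /= -RintegralB//; [|exact: intg_cos|exact: intg_sin].
  set l1 := \int[_]_x _; set l2 := \int[_]_x _.
  have -> : l2 = l1 by congr Rintegral; apply/funext => x; rewrite mulNr.
  suff -> : (fun k => \int[leb R n]_x (p x * w1 k x + - q x * w2 k x)) =
      (fun k => complex.Re (Fa a (u k) (v k))) by [].
  apply/funext => k; congr Rintegral; apply/funext => x.
  rewrite /p /q /w1 /w2; case: (a x) (u k x) (v k x) => [a1 a2] [b1 b2] [c1 c2] /=; ring.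
- have := lim p q w2 w1 _ _ ip iq (fun=> erefl) (fun=> erefl) mw2 mw1 w2B w1B cw2 cw1.
  rewrite /fourier /= -RintegralD//; [|exact: intg_sin|exact: intg_cos].
  suff -> : (fun k => \int[leb R n]_x (p x * w2 k x + q x * w1 k x)) =
      (fun k => complex.Im (Fa a (u k) (v k))) by [].
  apply/funext => k; congr Rintegral; apply/funext => x.
  rewrite /p /q /w1 /w2; case: (a x) (u k x) (v k x) => [a1 a2] [b1 b2] [c1 c2] /=; ring.
Qed.

Lemma finite_rank_det (a : T -> C) : (0 < n)%N -> L1 a -> toeplitz_finite_rank a ->
  exists N, forall xi eta : 'I_N -> T,
    (forall i, dotR (xi i) (xi i) = 1) -> (forall i, dotR (eta i) (eta i) = 1) ->
    \det (\matrix_(i < N, j < N) fourier (fun x => complex.Re (a x)) (fun x => complex.Im (a x))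
             (addRd n (xi i) (oppRd (eta j)))) = 0.
Proof.
(* With one point more than the number of functions spanning the range, the matrix of the form on
   cap functions factors through dimension [k]: the coefficients depend on the row, the inner
   products on the column. *)
move=> n0 La [k [psi [_ rk]]]; exists k.+1 => xi eta xi1 eta1.
have [ph hph] := choice (fun i => herglotz_delta n (xi i) n0 (xi1 i)).
have [ps hps] := choice (fun i => herglotz_delta n (eta i) n0 (eta1 i)).
apply: (@cvgC0_eq0 _ (fun m => \det (\matrix_(i, j) Fa a (herglotz (ph i m)) (herglotz (ps j m))))).
  move=> m.
  have /choice[c cE] : forall i, exists c : 'I_k -> C, forall j,
      Fa a (herglotz (ph i m)) (herglotz (ps j m)) = \sum_(l < k) c l * H_inner (psi l) (ps j m).
    move=> i; have [hL _ _ _] := hph i; have [c hc] := rk _ (hL m).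
    by exists c => j; apply: hc; have [] := hps j.
  rewrite (_ : (\matrix_(i, j) _) = (\matrix_(i, l) c i l) *m (\matrix_(l, j) H_inner (psi l) (ps j m))).
    exact: det_low_rank.
  apply/matrixP => i j; rewrite !mxE cE; apply: eq_bigr => l _; by rewrite !mxE.
apply: cvgC_det => i j; rewrite mxE.
rewrite (_ : (fun m => _) = (fun m => Fa a (herglotz (ph i m)) (herglotz (ps j m)))).
  have [_ m1 b1 c1] := hph i; have [_ m2 b2 c2] := hps j.
  exact: cvgC_Fa.
by apply/funext => m; rewrite mxE.
Qed.

End Kernel.

(** * Vanishing of the Fourier transform *)

Section FourierLimits.
Context {R : realType} {n : nat}.
Notation T := (Rd R n).
Variables (p q : T -> R).
Hypotheses (ip : intg p) (iq : intg q).

Lemma taylor_entire_fourier (r : R) (th v : T) :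
  (forall x, r < dotR x x -> p x = 0) -> (forall x, r < dotR x x -> q x = 0) ->
  componentwise taylor_entire (fun c => fourier p q (addRd n th (scaleRd c v))).
Proof.
move=> pr qr; split => /=; apply: taylor_entireD.
- exact: taylor_entire_FC ip pr.
- by apply: taylor_entireN; exact: taylor_entire_FS iq qr.
- exact: taylor_entire_FS ip pr.
- exact: taylor_entire_FC iq qr.
Qed.

(** Convergence of the frequencies is tested on pairings, which is all that the integrand sees of
    them; dominated convergence does the rest. *)
Lemma cvgC_fourier (y_ : nat -> T) y :
  (forall x, (fun k => dotR x (y_ k)) @ \oo --> dotR x y) ->
  cvgC (fun k => fourier p q (y_ k)) (fourier p q y).
Proof.
move=> yy.
have H b (g : R -> R) : intg b -> (forall t, `|g t| <= 1) -> continuous g ->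
    (fun k => \int[leb R n]_x (b x * g (dotR x (y_ k)))) @ \oo --> \int[leb R n]_x (b x * g (dotR x y)).
  move=> ib g1 gc.
  have ig : intg (fun x => `|b x|) by exact: integrable_norm.
  have [||| _ _ //] := Rintegral_dominated _ _ _ (leb R n)
    (fun k x => b x * g (dotR x (y_ k))) (fun x => b x * g (dotR x y)) (fun x => `|b x|) _ ig.
  - move=> k; apply: measurable_funM; first exact: intg_measurable.
    apply: (@measurableT_comp _ _ _ _ _ _ g); last exact: measurable_dotRl.
    exact: continuous_measurable_fun.
  - by move=> k x; rewrite normrM ler_piMr.
  - move=> x; apply: cvgMr.
    exact: (continuous_cvg _ (gc _) (yy x)).
split => /=.
- apply: cvgB; [apply: (H _ cos) => //|apply: (H _ sin) => //].
  + by move=> t; exact: cos_max.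
  + exact: continuous_cos.
  + by move=> t; exact: sin_max.
  + exact: continuous_sin.
- apply: cvgD; [apply: (H _ sin) => //|apply: (H _ cos) => //].
  + by move=> t; exact: sin_max.
  + exact: continuous_sin.
  + by move=> t; exact: cos_max.
  + exact: continuous_cos.
Qed.

End FourierLimits.

Lemma componentwise_taylor_eq0 {R : realType} (f : R -> R[i]) (r : R) :
  componentwise taylor_entire f -> 0 < r -> (forall c, `|c| <= r -> f c = 0) ->
  forall c, f c = 0.
Proof.
move=> [f1 f2] r0 f0 c.
have h1 := taylor_entire_eq0 _ _ f1 r0 _ c; have h2 := taylor_entire_eq0 _ _ f2 r0 _ c.
case: (f c) h1 h2 => a b /= h1 h2.
by rewrite h1 ?h2// => t tr; rewrite f0.
Qed.

Lemma cvgC_riemann_lebesgue {R : realType} n (p q : Rd R n.+1 -> R) (th v : Rd R n.+1) :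
  intg p -> intg q -> v.2 != 0 ->
  cvgC (fun k => fourier p q (addRd n.+1 th (scaleRd k%:R v))) 0.
Proof.
move=> ip iq v0.
have [_ /(_ th)[h1 h2]] := riemann_lebesgue n v p v0 ip.
have [_ /(_ th)[h3 h4]] := riemann_lebesgue n v q v0 iq.
split => /=; first by rewrite -[0 : R](subr0 0); exact: cvgB.
by rewrite -[0 : R](addr0 0); exact: cvgD.
Qed.

Lemma dotR_orthogonal {R : realType} n (t u e : Rd R n) (h c w : R) :
  dotR t u = 0 -> dotR t e = 0 -> dotR u e = 0 ->
  let x := addRd n (scaleRd h t) (addRd n (scaleRd c u) (scaleRd w e)) in
  dotR x x = h ^+ 2 * dotR t t + c ^+ 2 * dotR u u + w ^+ 2 * dotR e e.
Proof.
move=> tu te ue x; rewrite /x !dotRDr !dotRDl !dotRZr !dotRZl.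
by rewrite (dotRC _ u t) (dotRC _ e t) (dotRC _ e u) tu te ue; ring.
Qed.

Section Vec4.
Context {R : realType} {m : nat}.

(** The last three coordinates host the plane of the u_i and n_i and the axis e; the block [a] of
    arbitrary dimension, possibly 0, holds t'. *)
Definition vec4 (a : Rd R m) (b c d : R) : Rd R m.+3 :=
  ((((a, b) : (Rd R m * R)%type), c) : ((Rd R m * R) * R)%type, d).

Lemma vec4P (z : Rd R m.+3) : exists a b c d, z = vec4 a b c d.
Proof.
exists (z : ((Rd R m * R) * R) * R).1.1.1, (z : ((Rd R m * R) * R) * R).1.1.2,
  (z : ((Rd R m * R) * R) * R).1.2, (z : ((Rd R m * R) * R) * R).2.
by rewrite /vec4 -!surjective_pairing.
Qed.

Lemma dotR_vec4 a b c d a' b' c' d' :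
  dotR (vec4 a b c d) (vec4 a' b' c' d') = dotR a a' + b * b' + c * c' + d * d'.
Proof. by []. Qed.

Lemma addRd_vec4 a b c d a' b' c' d' :
  addRd m.+3 (vec4 a b c d) (vec4 a' b' c' d')
    = vec4 (addRd m a a') (b + b') (c + c') (d + d').
Proof. by []. Qed.

Lemma scaleRd_vec4 t a b c d :
  scaleRd t (vec4 a b c d) = vec4 (scaleRd t a) (t * b) (t * c) (t * d).
Proof. by []. Qed.

Lemma last_vec4 a b c d : (vec4 a b c d).2 = d.
Proof. by []. Qed.
End Vec4.

Lemma half_gap {R : realFieldType} (s P : R) (k : nat) : 0 < s < P ->
  0 < s + (P - s) / 2 * k.+1%:R^-1 < P.
Proof.
move=> /andP[s0 sP].
have h : 0 < k.+1%:R^-1 :> R by rewrite invr_gt0.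
have h2 : k.+1%:R^-1 <= 1 :> R by rewrite invf_le1 ?ltr0n// ler1n.
have dl0 : 0 < (P - s) / 2 by lra.
have h3 : 0 < (P - s) / 2 * k.+1%:R^-1 by rewrite mulr_gt0.
have h4 : (P - s) / 2 * k.+1%:R^-1 <= (P - s) / 2 by rewrite ler_piMr// ltW.
by move: (_ * k.+1%:R^-1) h3 h4 => t h3 h4; apply/andP; split; lra.
Qed.

(** The first expression is [|b + c y|^2] for a unit vector [b] with [<b, y> = t] and [|y|^2 = Y].
    The two conclusions place [b + c y] in the open half-ball of radius 2 where the transform is
    shown to vanish. *)
Lemma segment_in_halfspace {R : realType} (t Y : R) : t ^+ 2 <= Y ->
  exists2 dl : R, 0 < dl & forall c, `|c| <= dl ->
    1 + 2 * (c * t) + c ^+ 2 * Y < 4 /\ 0 < 1 + c * t.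
Proof.
move=> tY; have Y0 : 0 <= Y by rewrite (le_trans _ tY)// sqr_ge0.
have Y1 : 0 < 2 * (1 + Y) by lra.
(* This radius makes both [|c t|] and [c^2 Y] at most [1/4], uniformly in [Y]. *)
exists (2 * (1 + Y))^-1; first by rewrite invr_gt0.
move=> c; set dl := _^-1 => c_dl.
have dl0 : 0 < dl by rewrite invr_gt0.
have dlE : dl * (2 * (1 + Y)) = 1 by rewrite mulVf// gt_eqF.
have cy : `|c * t| <= 4^-1.
  rewrite normrM; apply: (@le_trans _ _ (dl * `|t|)); first by rewrite ler_wpM2r.
  have h : 2 * `|t| <= 1 + Y.
    have : 0 <= (`|t| - 1) ^+ 2 by rewrite sqr_ge0.
    have : `|t| ^+ 2 = t ^+ 2 by rewrite real_normK ?num_real.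
    by rewrite !expr2; nra.
  have : dl * (2 * `|t|) <= dl * (1 + Y) by rewrite ler_wpM2l// ltW.
  lra.
have cc : c ^+ 2 * Y <= 4^-1.
  apply: (@le_trans _ _ (dl ^+ 2 * Y)).
    by rewrite ler_wpM2r// -[leLHS]real_normK ?num_real// lerXn2r ?nnegrE// ltW.
  have dlY : 0 <= dl * Y by rewrite mulr_ge0// ltW.
  have d1 : dl <= 2^-1 by nra.
  have d2 : dl * Y <= 2^-1 by nra.
  by rewrite expr2; nra.
by move: cy; rewrite ler_norml => /andP[cy1 cy2]; split; lra.
Qed.

Section Geometry.
Context {R : realType} {m : nat}.
Notation T := (Rd R m.+3).
Variables (p q : T -> R) (r : R) (N : nat).
Hypotheses (ip : intg p) (iq : intg q).
Hypotheses (pr : forall x, r < dotR x x -> p x = 0).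
Hypotheses (qr : forall x, r < dotR x x -> q x = 0).
Hypothesis kernel_det : forall xi eta : 'I_N -> T,
  (forall i, dotR (xi i) (xi i) = 1) -> (forall i, dotR (eta i) (eta i) = 1) ->
  \det (\matrix_(i < N, j < N) fourier p q (addRd m.+3 (xi i) (oppRd (eta j)))) = 0.

Section Frame.
Variables (t' : Rd R m) (f1 f2 tau : R).
Hypotheses (f_unit : f1 ^+ 2 + f2 ^+ 2 = 1) (t_lt2 : dotR t' t' + tau ^+ 2 < 4).

(* freq s and normal s play the roles of t_i and n_i for s = s_i, and axis that
   of e. *)
Definition freq (s : R) : T := vec4 t' (tau * cos s * f1) (tau * cos s * f2) (tau * sin s).
Definition normal (s : R) : T := vec4 (zeroRd m) (- sin s * f1) (- sin s * f2) (cos s).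
Definition axis : T := vec4 (zeroRd m) f2 (- f1) 0.

Let trig s : cos s ^+ 2 + sin s ^+ 2 = 1 :> R.
Proof. by rewrite cos2Dsin2. Qed.

Let dot_ff s : dotR (freq s) (freq s) = dotR t' t' + tau ^+ 2.
Proof.
transitivity (dotR t' t' + tau ^+ 2 * (cos s ^+ 2 * (f1 ^+ 2 + f2 ^+ 2) + sin s ^+ 2)).
  by rewrite /freq dotR_vec4; ring.
by rewrite f_unit mulr1 trig mulr1.
Qed.

Let dot_nn s : dotR (normal s) (normal s) = 1.
Proof.
transitivity (sin s ^+ 2 * (f1 ^+ 2 + f2 ^+ 2) + cos s ^+ 2).
  by rewrite /normal dotR_vec4 dotR0r; ring.
by rewrite f_unit mulr1 addrC trig.
Qed.

Let dot_aa : dotR axis axis = 1.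
Proof. by rewrite -f_unit /axis dotR_vec4 dotR0r; ring. Qed.

Let dot_fn s : dotR (freq s) (normal s) = 0.
Proof.
transitivity (tau * cos s * sin s * (1 - (f1 ^+ 2 + f2 ^+ 2))).
  by rewrite /freq /normal dotR_vec4 dotR0r; ring.
by rewrite f_unit subrr mulr0.
Qed.

Let dot_fa s : dotR (freq s) axis = 0.
Proof. by rewrite /freq /axis dotR_vec4 dotR0r; ring. Qed.

Let dot_na s : dotR (normal s) axis = 0.
Proof. by rewrite /normal /axis dotR_vec4 dotR0r; ring. Qed.

Let rho2 : R := 1 - (dotR t' t' + tau ^+ 2) / 4.
Let rho2_gt0 : 0 < rho2.
Proof. by rewrite /rho2; move: t_lt2; lra. Qed.

Lemma prod_fourier_eq0 (s : 'I_N -> R) : (forall i, 0 < s i < pi) -> injective s ->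
  \prod_(i < N) fourier p q (freq (s i)) = 0.
Proof.
move=> s0pi sinj.
pose th i j : T := scaleRd 2^-1 (addRd m.+3 (freq (s i)) (freq (s j))).
pose v i j : T := addRd m.+3 (normal (s i)) (oppRd (normal (s j))).
pose M (c : R) : 'M[R[i]]_N := \matrix_(i, j) fourier p q (addRd m.+3 (th i j) (scaleRd c (v i j))).
have M0 c : \det (M c) = 0.
  (* For [|c|] up to [sqrt rho2] a real [w] with [c^2 + w^2 = rho2] exists, and only there are the
     points on the real sphere. *)
  apply: (@componentwise_taylor_eq0 _ (fun c => \det (M c)) (Num.sqrt rho2)).
  - apply: componentwise_det.
    + exact: taylor_entire_cst.
    + exact: taylor_entireD.
    + exact: taylor_entireM.
    move=> i j; rewrite /M; under [fun c => _]eq_fun do rewrite mxE.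
    exact: (taylor_entire_fourier _ _ ip iq _ _ _ pr qr).
  - by rewrite sqrtr_gt0.
  move=> {}c cr; pose w := Num.sqrt (rho2 - c ^+ 2).
  have w2 : w ^+ 2 = rho2 - c ^+ 2.
    rewrite sqr_sqrtr// subr_ge0 -(sqr_sqrtr (ltW rho2_gt0)) -[leLHS]real_normK ?num_real//.
    by rewrite lerXn2r ?nnegrE ?sqrtr_ge0.
  (* [h = 1/2] gives the rows and [h = -1/2] the columns. One [w] serves all indices because the
     vectors [freq (s i)] have equal length. *)
  pose sph (h : R) i : T := addRd m.+3 (scaleRd h (freq (s i)))
    (addRd m.+3 (scaleRd c (normal (s i))) (scaleRd w axis)).
  have sph1 h i : h ^+ 2 = 4^-1 -> dotR (sph h i) (sph h i) = 1.
    by move=> h2; rewrite dotR_orthogonal// dot_ff dot_nn dot_aa w2 h2 /rho2; field.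
  have := kernel_det (sph 2^-1) (sph (- 2^-1)) _ _.
  have h4 : 2^-1 ^+ 2 = 4^-1 :> R by rewrite exprVn; congr (_^-1); ring.
  move=> <- //; [|by move=> i; exact: sph1|by move=> i; apply: sph1; rewrite sqrrN].
  congr (\det _); apply/matrixP => i j; rewrite !mxE; apply: fourier_ext => x.
  by rewrite /th /v /sph /oppRd !(dotRDr, dotRZr); ring.
pose L : 'M[R[i]]_N := diag_mx (\row_i fourier p q (freq (s i))).
have : \det L = 0.
  apply: (@cvgC0_eq0 _ (fun k : nat => \det (M k%:R))); first by move=> k; exact: M0.
  apply: cvgC_det => i j; rewrite /M /L.
  rewrite (_ : (fun k => _) = (fun k : nat => fourier p q (addRd m.+3 (th i j) (scaleRd k%:R (v i j))))); last first.
    by apply/funext => k; rewrite mxE.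
  rewrite !mxE; have [<-|ij] := eqVneq i j.
    rewrite mulr1n (_ : (fun k => _) = (fun=> fourier p q (freq (s i)))).
      by split; exact: cvg_cst.
    apply/funext => k; apply: fourier_ext => x.
    by rewrite /th /v /oppRd !(dotRDr, dotRZr); field.
  rewrite mulr0n; apply: cvgC_riemann_lebesgue => //.
  (* The last coordinate of [v i j] is [cos (s i) - cos (s j)]. It is nonzero because the angles are
     distinct and the cosine is injective on [[0, pi]]. *)
  rewrite /v /normal /oppRd scaleRd_vec4 addRd_vec4 last_vec4 mulN1r subr_eq0; apply: contraNneq ij => cc.
  apply/eqP; apply: sinj; apply: cos_inj cc; rewrite in_itv/=.
    by have /andP[h1 h2] := s0pi i; rewrite !ltW.
  by have /andP[h1 h2] := s0pi j; rewrite !ltW.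
by rewrite det_diag; under eq_bigr do rewrite mxE.
Qed.

(** If the value at [s0] were nonzero, continuity would make it nonzero at all late terms of a
    sequence of distinct angles decreasing to [s0]; any [N] of these contradict
    [prod_fourier_eq0]. *)
Lemma fourier_freq_eq0 s0 : 0 < s0 < pi -> fourier p q (freq s0) = 0.
Proof.
move=> /andP[s00 s0pi]; apply/eqP; apply: contraT => nz.
pose dl : R := (pi - s0) / 2; have dl0 : 0 < dl by rewrite divr_gt0// subr_gt0.
pose s k := s0 + dl * k.+1%:R^-1.
have sc : s @ \oo --> s0.
  rewrite -[X in _ --> X]addr0; apply: cvgD; first exact: cvg_cst.
  by rewrite -[X in _ --> X](mulr0 dl); apply: cvgMr; exact: cvg_harmonic.
have s_itv k : 0 < s k < pi by apply: half_gap; rewrite s00.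
have fc : cvgC (fun k => fourier p q (freq (s k))) (fourier p q (freq s0)).
  apply: (cvgC_fourier _ _ ip iq) => x; have [x' [x1 [x2 [x3 ->]]]] := vec4P x.
  under eq_fun do rewrite /freq dotR_vec4; rewrite dotR_vec4.
  have cs : (fun k => cos (s k)) @ \oo --> cos s0.
    by apply: continuous_cvg sc; exact: continuous_cos.
  have ss : (fun k => sin (s k)) @ \oo --> sin s0.
    by apply: continuous_cvg sc; exact: continuous_sin.
  apply: cvgD.
    apply: cvgD; first (apply: cvgD; first exact: cvg_cst);
      by apply: cvgMr; apply: cvgMl; apply: cvgMr.
  by apply: cvgMr; apply: cvgMr.
have [K hK] : exists K, forall k, (K <= k)%N -> fourier p q (freq (s k)) != 0.
  have nzr (u : nat -> R) l : u @ \oo --> l -> l != 0 -> \forall k \near \oo, u k != 0.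
    by move=> ul l0; exact: (cvgr_neq0 l ul l0).
  have [h1 h2] := fc; move: nz; rewrite eq_complex negb_and => /orP[] /=.
    move=> /(nzr _ _ h1)[K _ hK]; exists K => k Kk; have := hK k Kk.
    by apply: contraNneq => E; rewrite E.
  move=> /(nzr _ _ h2)[K _ hK]; exists K => k Kk; have := hK k Kk.
  by apply: contraNneq => E; rewrite E.
have := prod_fourier_eq0 (fun i : 'I_N => s (K + i)%N).
case/(_ _ _)/eqP/prodf_eq0.
- by move=> i; exact: s_itv.
- move=> i j /addrI/(mulfI (lt0r_neq0 dl0))/invr_inj/eqP.
  by rewrite eqr_nat eqSS eqn_add2l => /eqP/val_inj.
by move=> i _; rewrite (negbTE (hK _ (leq_addr _ _))).
Qed.

End Frame.

(** Polar coordinates: [(f1, f2)] is the direction of [(t1, t2)], [tau] the length of [(t1, t2, t3)]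
    and [s] its angle to the plane of the first two coordinates. Positivity of [t3] puts [s]
    strictly between 0 and [pi]. *)
Lemma fourier_vec4_eq0 (t' : Rd R m) (t1 t2 t3 : R) :
  dotR t' t' + (t1 ^+ 2 + t2 ^+ 2 + t3 ^+ 2) < 4 -> 0 < t3 ->
  fourier p q (vec4 t' t1 t2 t3) = 0.
Proof.
move=> lt4 t30.
pose r2 := t1 ^+ 2 + t2 ^+ 2; pose rr := Num.sqrt r2.
have r20 : 0 <= r2 by rewrite addr_ge0// sqr_ge0.
have rr2 : rr ^+ 2 = r2 by rewrite sqr_sqrtr.
have rr0 : 0 <= rr by rewrite sqrtr_ge0.
have [f1 [f2 [fu e1 e2]]] : exists f1 f2, [/\ f1 ^+ 2 + f2 ^+ 2 = 1, rr * f1 = t1 & rr * f2 = t2].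
  (* When [t1 = t2 = 0] there is no direction to normalise and any unit vector serves. *)
  have [z|nz] := eqVneq rr 0.
    exists 1, 0; rewrite z !mul0r expr1n expr0n addr0.
    have : r2 = 0 by rewrite -rr2 z expr0n.
    by rewrite /r2 => h; split => //; apply/eqP; rewrite eq_sym -sqrf_eq0; apply/eqP;
      have := sqr_ge0 t1; have := sqr_ge0 t2; lra.
  exists (t1 / rr), (t2 / rr); split; [|by rewrite mulrC divfK|by rewrite mulrC divfK].
  by rewrite !expr_div_n -mulrDl -/r2 -rr2 mulfV// expf_neq0.
pose tau := Num.sqrt (r2 + t3 ^+ 2).
have tau2 : tau ^+ 2 = r2 + t3 ^+ 2 by rewrite sqr_sqrtr// addr_ge0// sqr_ge0.
have tau0 : 0 < tau by rewrite sqrtr_gt0 ltr_wpDl// exprn_gt0.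
have rrtau : rr <= tau.
  by rewrite /rr /tau ler_sqrt ?lerDl ?sqr_ge0// addr_ge0// sqr_ge0.
have c1 : -1 <= rr / tau <= 1.
  rewrite ler_pdivrMr// mul1r rrtau andbT; apply: (@le_trans _ _ 0); first lra.
  by rewrite divr_ge0// ltW.
pose s := acos (rr / tau).
have cs : tau * cos s = rr by rewrite /s acosK ?in_itv//= mulrC divfK// gt_eqF.
have ss : tau * sin s = t3.
  have tn : tau != 0 by rewrite gt_eqF.
  have h : 1 - (rr / tau) ^+ 2 = (t3 / tau) ^+ 2.
    by rewrite !expr_div_n rr2 -[1](mulfV (expf_neq0 2 tn)) -mulrBl tau2; congr (_ / _); ring.
  rewrite /s sin_acos// h sqrtr_sqr ger0_norm; first by rewrite mulrC divfK.
  by rewrite divr_ge0// ltW.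
have s0pi : 0 < s < pi.
  have sp : 0 < sin s by rewrite -(pmulr_rgt0 _ tau0) ss.
  rewrite !lt_neqAle acos_ge0// acos_lepi// !andbT; apply/andP; split; apply: contraTneq sp.
    by move=> <-; rewrite sin0 ltxx.
  by rewrite -/s => ->; rewrite sinpi ltxx.
have := fourier_freq_eq0 t' f1 f2 tau fu _ s s0pi.
by rewrite /freq cs ss e1 e2 tau2; apply.
Qed.

(** The base point [b] lies inside the half-ball of [fourier_vec4_eq0]. On the line from [b] through
    [z] the transform vanishes near [b], hence at parameter 1, which is [z]. *)
Lemma fourier_eq0 (z : T) : fourier p q z = 0.
Proof.
pose b : T := vec4 (zeroRd m) 0 0 1.
suff H y : fourier p q (addRd m.+3 b (scaleRd 1 y)) = 0.
  rewrite -[RHS](H (addRd m.+3 z (oppRd b))); apply: fourier_ext => x.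
  by rewrite /oppRd !(dotRDr, dotRZr); ring.
have [y' [y1 [y2 [y3 ->]]]] := vec4P y.
pose Y := dotR y' y' + y1 ^+ 2 + y2 ^+ 2 + y3 ^+ 2.
have yY : y3 ^+ 2 <= Y by rewrite /Y lerDr !addr_ge0 ?sqr_ge0 ?dotR_ge0.
have [dl dl0 dlP] := segment_in_halfspace _ _ yY.
apply: (@componentwise_taylor_eq0 _ (fun c => fourier p q (addRd m.+3 b (scaleRd c (vec4 y' y1 y2 y3)))) dl).
- exact: (taylor_entire_fourier _ _ ip iq _ _ _ pr qr).
- exact: dl0.
move=> c /dlP[h1 h2]; rewrite /b scaleRd_vec4 addRd_vec4.
apply: fourier_vec4_eq0; last exact: h2.
apply: le_lt_trans h1; rewrite le_eqVlt; apply/orP; left; apply/eqP.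
rewrite dotRDr !dotRDl dotRZr !dotRZl dotRZr !dotR0r (dotRC _ (zeroRd m)) dotR0r /Y.
by move: (dotR y' y') => u; ring.
Qed.

End Geometry.

(** * Separating real and imaginary parts, and null sets *)

Section Conclusion.
Context {R : realType} {n : nat}.
Notation T := (Rd R n).
Implicit Types (b p q : T -> R).

Lemma FC_FS_ae b b' y : intg b -> intg b' -> {ae leb R n, forall x, b x = b' x} ->
  FC b y = FC b' y /\ FS b y = FS b' y.
Proof.
move=> ib ib' bb'.
have H (g : T -> R) : intg (fun x => b x * g x) -> intg (fun x => b' x * g x) ->
    \int[leb R n]_x (b x * g x) = \int[leb R n]_x (b' x * g x).
  move=> i1 i2; congr fine; apply: ae_eq_integral => //.
  - exact: measurable_int i1.
  - exact: measurable_int i2.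
  - by apply: filterS bb' => x -> _.
by split; apply: H; (exact: intg_cos || exact: intg_sin).
Qed.

(** Cosine transforms are even and sine transforms odd, so comparing the values at [y] and [-y]
    separates the transforms of [p] from those of [q]. *)
Lemma fourier_injectiveC p q : intg p -> intg q -> (forall y, fourier p q y = 0) ->
  {ae leb R n, forall x, p x = 0} /\ {ae leb R n, forall x, q x = 0}.
Proof.
move=> ip iq f0.
have evenC b y : FC b (oppRd y) = FC b y.
  by congr Rintegral; apply/funext => x; rewrite dotRNr cosN.
have oddS b y : intg b -> FS b (oppRd y) = - FS b y.
  move=> ib; rewrite -mulN1r -RintegralZl//; last exact: intg_sin.
  by congr Rintegral; apply/funext => x; rewrite dotRNr sinN mulrN mulN1r.
have H y : [/\ FC p y = 0, FS p y = 0, FC q y = 0 & FS q y = 0].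
  have := f0 y; have := f0 (oppRd y); rewrite /fourier !evenC !oddS//.
  by move=> [h1 h2] [h3 h4]; split; lra.
by split; apply: fourier_injective => // y; have [] := H y.
Qed.

End Conclusion.

Theorem theorem6p3 (R : realType) (d : nat) (a : Rd R d -> R[i]) :
  (3 <= d)%N ->
  L1 a ->
  compact_support a ->
  toeplitz_finite_rank a ->
  {ae leb R d, forall x, a x = 0}.
Proof.
case: d a => [|[|[|m]]] a // _ La [r ar] fr.
have [N hN] := finite_rank_det a isT La fr.
have [ip iq] := intg_L1 a La.
set p0 := fun x => complex.Re (a x) in ip hN.
set q0 := fun x => complex.Im (a x) in iq hN.
(* The support condition holds only almost everywhere, while the analyticity lemmas ask for it at
   every point. Cutting the symbol off to [B] repairs this without changing its transform. *)
pose B : set (Rd R m.+3) := [set x | dotR x x <= r].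
have mB : measurable B.
  have mm : measurable_fun setT (fun x : Rd R m.+3 => dotR x x).
    by apply: measurable_dotR; exact: measurable_id.
  have := mm measurableT `]-oo, r]%classic (measurable_itv _); rewrite setTI.
  by congr measurable; apply/seteqP; split => x /=; rewrite in_itv.
have iB (b : Rd R m.+3 -> R) : intg b -> intg (fun x => b x * \1_B x).
  by move=> ib; apply: intgM => // x; rewrite indicE; case: (_ \in _); rewrite ?normr1 ?normr0.
have out (b : Rd R m.+3 -> R) x : r < dotR x x -> b x * \1_B x = 0.
  by move=> rx; rewrite indicE memNset ?mulr0// /B /= leNgt rx.
have aeB (g : R[i] -> R) : g 0 = 0 ->
    {ae leb R m.+3, forall x, g (a x) = g (a x) * \1_B x}.
  move=> g0; apply: filterS ar => x hx; rewrite indicE.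
  have [xB|xB] := leP (dotR x x) r; first by rewrite mem_set ?mulr1.
  by rewrite hx// g0 mul0r.
have fE y : fourier p0 q0 y = fourier (fun x => p0 x * \1_B x) (fun x => q0 x * \1_B x) y.
  have [e1 e2] := FC_FS_ae _ _ y ip (iB _ ip) (aeB (@complex.Re R) erefl).
  have [e3 e4] := FC_FS_ae _ _ y iq (iB _ iq) (aeB (@complex.Im R) erefl).
  by rewrite /fourier e1 e2 e3 e4.
have f0 y : fourier p0 q0 y = 0.
  rewrite fE; apply: (fourier_eq0 _ _ r N (iB _ ip) (iB _ iq) (out _) (out _)).
  move=> xi eta x1 e1; rewrite -[RHS](hN xi eta x1 e1); congr (\det _).
  by apply/matrixP => i j; rewrite !mxE fE.
have [ae1 ae2] := fourier_injectiveC p0 q0 ip iq f0.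
apply: filterS2 ae1 ae2 => x; rewrite /p0 /q0.
by case: (a x) => u v /= -> ->.
Qed.
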